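(* For every $L_F\ge\mu_F>0$, $\chi_W\ge 1$ and $\chi_A\ge 1$ there exist a decentralized affine-constrained problem $$\min_{x_1,\dots,x_n}\ \sum_{i=1}^n f_i(x_i)\quad\text{s.t. } A_ix_i=b_i\ (i=1,\dots,n),\quad x_1=\dots=x_n,$$ with each $f_i$ $L_F$-smooth and $\mu_F$-strongly convex, initial points $x_i^0$, a static communication graph $G$ on the agents $\{1,\dots,n\}$ with a gossip matrix $W$ satisfying $\lambda_{\max}(W)/\lambda_{\min}^+(W)=\chi_W$, and with the matrix $\mathbf A=\mathrm{diag}(A_1,\dots,A_n)$ satisfying $\lambda_{\max}(\mathbf A^\top\mathbf A)/\lambda_{\min}^+(\mathbf A^\top\mathbf A)=\chi_A$, such that any first-order decentralized algorithm (as defined in the context) requires at least $$N=\Theta\Big(\sqrt{L_F/\mu_F}\,\log\tfrac1\varepsilon\Big)\ \text{sequential local computations},$$ $$\Theta\big(N\sqrt{\chi_W}\big)\ \text{communications},\qquad \Theta\big(N\sqrt{\chi_A}\big)\ \text{multiplications by }\mathbf A^\top\mathbf A$$ to produce approximate solutions $x_i$ with $\|x_i-x^*\|^2\le\varepsilon$ for all $i\in\{1,\dots,n\}$, where $x_1=\dots=x_n=x^*$ is the solution of the problem.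
   Context: Setting: $n$ agents; agent $i$ privately holds $f_i$, $A_i$, $b_i$. The local variables $x_i$ live in $\mathbb R^d$; for the lower bounds $d=\infty$ is allowed (the space $\ell_2$ of square-summable sequences, matrices being bounded linear operators). A differentiable $f$ is $\mu$-strongly convex if $f(y)\ge f(x)+\langle\nabla f(x),y-x\rangle+\frac\mu2\|y-x\|^2$ and $L$-smooth if $f(y)\le f(x)+\langle\nabla f(x),y-x\rangle+\frac L2\|y-x\|^2$ for all $x,y$. $f^*$ is the Fenchel conjugate. $\lambda_{\max}$ and $\lambda_{\min}^+$ are the largest and the smallest positive eigenvalue. Gossip matrix: an $n\times n$ matrix $W$ is a gossip matrix of an undirected graph $G=(V,E)$, $|V|=n$, if (1) $W$ is symmetric positive semidefinite; (2) $[W]_{ij}\ne0$ iff $(i,j)\in E$ or $i=j$; (3) $Wv=0$ iff $v_1=\dots=v_n$. First-order decentralized algorithm: agent $i$ has a local memory $\mathcal M_i(k)$ at step $k$, with $\mathcal M_i(0)=\{x_i^0\}$, and $E(k)$ is the edge set of the communication graph at step $k$ (here $E(k)=E$ for all $k$). At step $k$ the allowed actions are the following three memory updates: (1) local computation: $\mathcal M_i(k)=\mathrm{span}(\{x,\nabla f_i(x),\nabla f_i^*(x): x\in\mathcal M_i(k)\})$; (2) decentralized communication: $\mathcal M_i(k)=\mathrm{span}(\{\mathcal M_j(k): (i,j)\in E(k)\})$; (3) matrix multiplication: $\mathcal M_i(k)=\mathrm{span}(\{b_i,A_i^\top A_ix: x\in\mathcal M_i(k)\})$. (In each formula, the right-hand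 side uses the memory before the action.) After each step $k$ the algorithm must provide a current approximate solution $x_i^k\in\mathcal M_i(k)$ and sets $\mathcal M_i(k+1)=\mathcal M_i(k)$. The numbers of sequential local computations, communications and multiplications count the actions of types (1), (2) and (3). $\Theta$ is standard order notation with absolute constants (independent of $L_F,\mu_F,\chi_W,\chi_A,\varepsilon$), in the regime of small $\varepsilon$ (how small may depend on the problem instance) and large $L_F/\mu_F$. *)

(* Defs.v *)
From HB Require Import structures.
From mathcomp Require Import all_boot all_order all_algebra.
From mathcomp Require Import all_classical all_reals all_analysis.
Set Implicit Arguments.
Unset Strict Implicit.
Unset Printing Implicit Defensive.
Import Order.TTheory GRing.Theory Num.Theory numFieldNormedType.Exports.
Local Open Scope classical_set_scope.
Local Open Scope ring_scope.

Section L2.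
Context {R : realType}.

Definition square_summable : {pred (nat -> R)} :=
  [pred u : nat -> R | `[< cvgn (series (fun k => u k ^+ 2)) >]].

Lemma square_summableP (u : nat -> R) :
  reflect (cvgn (series (fun k => u k ^+ 2))) (u \in square_summable).
Proof. by rewrite inE; exact: asboolP. Qed.

Lemma square_summable_mul (u v : nat -> R) :
  u \in square_summable -> v \in square_summable ->
  cvgn (series (fun k => u k * v k)).
Proof.
move=> /square_summableP cu /square_summableP cv.
apply: normed_cvg.
apply: (@series_le_cvg _ _ ((fun k => u k ^+ 2) + (fun k => v k ^+ 2))).
- by move=> n; rewrite normr_ge0.
- by move=> n; rewrite addr_ge0// sqr_ge0.
- move=> n /=; rewrite normrM.
  change (`|u n| * `|v n| <= u n ^+ 2 + v n ^+ 2).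
  rewrite -(real_normK (num_real (u n))) -(real_normK (num_real (v n))).
  have := sqr_ge0 (`|u n| - `|v n|).
  have := mulr_ge0 (normr_ge0 (u n)) (normr_ge0 (v n)).
  rewrite sqrrB; set a := `|u n|; set b := `|v n| => ab0 h.
  have : a * b + (a * b) <= a ^+ 2 + b ^+ 2.
    by rewrite -subr_ge0 -mulr2n addrAC.
  by apply: le_trans; rewrite lerDl.
- exact: is_cvg_seriesD.
Qed.

Lemma square_summable_submod : submod_closed square_summable.
Proof.
split.
  apply/square_summableP; rewrite (_ : series _ = cst 0); first exact: is_cvg_cst.
  by apply/funext => n; rewrite /series/= big1// => i _; rewrite expr0n.
move=> a u v uS vS; apply/square_summableP.
have cu : cvgn (series (fun k => u k ^+ 2)) by exact/square_summableP.
have cv : cvgn (series (fun k => v k ^+ 2)) by exact/square_summableP.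
have cuv := square_summable_mul uS vS.
rewrite (_ : (fun k => _) = a ^+ 2 *: (fun k => u k ^+ 2) +
   ((a *+ 2) *: (fun k => u k * v k) + (fun k => v k ^+ 2))); last first.
  apply/funext => k.
  change ((a * u k + v k) ^+ 2 =
    a ^+ 2 * u k ^+ 2 + ((a *+ 2) * (u k * v k) + v k ^+ 2)).
  by rewrite sqrrD exprMn mulrnAl mulr2n !mulrA !addrA.
have Zcu := @is_cvg_seriesZ _ _ (a ^+ 2) cu.
have Zcuv := @is_cvg_seriesZ _ _ (a *+ 2) cuv.
exact: (@is_cvg_seriesD _ _ _ Zcu (@is_cvg_seriesD _ _ _ Zcuv cv)).
Qed.

HB.instance Definition _ :=
  GRing.isSubmodClosed.Build R (nat -> R) square_summable square_summable_submod.

End L2.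

Record l2 (R : realType) := L2 {
  l2seq :> nat -> R;
  l2seqP : l2seq \in square_summable }.

HB.instance Definition _ (R : realType) := [isSub for @l2seq R].
HB.instance Definition _ (R : realType) := [Choice of l2 R by <:].
HB.instance Definition _ (R : realType) := [SubChoice_isSubLmodule of l2 R by <:].

Section L2norm.
Context {R : realType}.
Implicit Types x y z : l2 R.

Definition dot x y : R := limn (series (fun k => x k * y k)).

Lemma dot_cvg x y : cvgn (series (fun k => x k * y k)).
Proof. by apply: square_summable_mul; exact: l2seqP. Qed.

Lemma dotC x y : dot x y = dot y x.
Proof.
by rewrite /dot; congr (limn (series _)); apply/funext => k; rewrite mulrC.
Qed.

Lemma dotP a x y z : dot (a *: x + y) z = a * dot x z + dot y z.
Proof.
have cZ : cvgn (series (a *: (fun k => x k * z k))).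
  by apply: is_cvg_seriesZ; exact: dot_cvg.
rewrite /dot (_ : (fun k => _) =
  a *: (fun k => x k * z k) + (fun k => y k * z k)); last first.
  apply/funext => k; change ((a * x k + y k) * z k = a * (x k * z k) + y k * z k).
  by rewrite mulrDl mulrA.
rewrite lim_seriesD//; last exact: dot_cvg.
by rewrite lim_seriesZ//; exact: dot_cvg.
Qed.

Lemma dotDl x y z : dot (x + y) z = dot x z + dot y z.
Proof. by have := dotP 1 x y z; rewrite scale1r mul1r. Qed.

Lemma dot0l z : dot 0 z = 0.
Proof. by have := dotP (-1) 0 0 z; rewrite scaleN1r oppr0 addr0 mulN1r addNr. Qed.

Lemma dotZl a x z : dot (a *: x) z = a * dot x z.
Proof. by have := dotP a x 0 z; rewrite dot0l !addr0. Qed.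

Lemma dotDr x y z : dot x (y + z) = dot x y + dot x z.
Proof. by rewrite dotC dotDl !(dotC x). Qed.

Lemma dotZr a x z : dot x (a *: z) = a * dot x z.
Proof. by rewrite dotC dotZl (dotC x). Qed.

Lemma sqr_le_dot x n : x n ^+ 2 <= dot x x.
Proof.
apply: limr_ge; first exact: dot_cvg.
exists n.+1 => // m /= nm.
rewrite /series/= (@big_cat_nat _ _ _ n.+1)//= big_nat_recr//= -expr2.
rewrite addrAC lerDr addr_ge0// sumr_ge0// => i _;
  by rewrite -expr2 sqr_ge0.
Qed.

Lemma dot_ge0 x : 0 <= dot x x.
Proof. exact: le_trans (sqr_ge0 _) (sqr_le_dot x 0%N). Qed.

Lemma dot_eq0 x : dot x x = 0 -> x = 0.
Proof.
move=> x0; apply/val_inj/funext => n /=.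
have := sqr_le_dot x n; rewrite x0 => h.
by apply/eqP; rewrite -sqrf_eq0 eq_le h sqr_ge0.
Qed.

Lemma dot_cauchy_schwarz x y : dot x y ^+ 2 <= dot x x * dot y y.
Proof.
have [y0|y0] := eqVneq (dot y y) 0.
  by rewrite y0 (dot_eq0 y0) dotC dot0l expr0n mulr0.
have yp : 0 < dot y y by rewrite lt_neqAle eq_sym y0 dot_ge0.
have := dot_ge0 (dot y y *: x + (- dot x y) *: y).
rewrite !(dotDl, dotDr, dotZl, dotZr) (dotC y x).
set a := dot x x; set b := dot x y; set d := dot y y => h.
have : 0 <= d * (a * d - b ^+ 2).
  apply: le_trans h _; rewrite le_eqVlt; apply/orP; left; apply/eqP.
  by rewrite mulrBr expr2 !(mulNr, mulrN) opprK (mulrC b d) addNr addr0 !mulrA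
     (mulrAC d d a).
by rewrite pmulr_rge0// subr_ge0.
Qed.

Definition l2norm x : R := Num.sqrt (dot x x).

Lemma l2norm_triangle x y : l2norm (x + y) <= l2norm x + l2norm y.
Proof.
rewrite /l2norm -[leRHS]ger0_norm ?addr_ge0 ?sqrtr_ge0// -sqrtr_sqr.
apply: ler_wsqrtr; rewrite sqrrD !sqr_sqrtr ?dot_ge0//.
rewrite dotDl !dotDr (dotC y x) addrA lerD2r -addrA lerD2l -mulr2n lerMn2r/=.
rewrite -sqrtrM ?dot_ge0//; apply: le_trans (ler_norm _) _.
by rewrite -sqrtr_sqr; apply: ler_wsqrtr; exact: dot_cauchy_schwarz.
Qed.

Lemma l2normZ a x : l2norm (a *: x) = `|a| * l2norm x.
Proof.
by rewrite /l2norm dotZl dotZr mulrA -expr2 sqrtrM ?sqr_ge0// sqrtr_sqr.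
Qed.

Lemma l2norm_eq0 x : l2norm x = 0 -> x = 0.
Proof.
move=> /eqP; rewrite sqrtr_eq0 => h; apply: dot_eq0.
by apply/eqP; rewrite eq_le h dot_ge0.
Qed.

End L2norm.

HB.instance Definition _ (R : realType) :=
  Lmodule_isNormed.Build R (l2 R) l2norm_triangle l2normZ l2norm_eq0.

Lemma l2_normE (R : realType) (x : l2 R) : `|x| = Num.sqrt (dot x x).
Proof. by []. Qed.

Section ConvexFunctions.
Context {R : realType}.
Implicit Types (f : l2 R -> R) (L mu : R).

Definition gradient f (x g : l2 R) : Prop := is_diff x f (dot g).

Definition has_gradient f : Prop := forall x, exists g, gradient f x g.

Definition strongly_convex mu f : Prop :=
  has_gradient f /\
  forall x g y, gradient f x g ->
    f y >= f x + dot g (y - x) + mu / 2 * `|y - x| ^+ 2.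

Definition smooth L f : Prop :=
  has_gradient f /\
  forall x g y, gradient f x g ->
    f y <= f x + dot g (y - x) + L / 2 * `|y - x| ^+ 2.

(* A real supremum: it is only used for strongly convex [f], whose conjugate is
   finite everywhere. *)
Definition fenchel f (y : l2 R) : R := sup (range (fun x => dot y x - f x)).

End ConvexFunctions.

Section Spectra.
Context {R : realType}.

Definition point_spectrum (V : lmodType R) (B : V -> V) : set R :=
  [set a | exists2 v : V, v != 0 & B v = a *: v].

(* For a bounded operator between Banach spaces a bijection has a bounded
   inverse, so continuity of the inverse need not be asked for. *)
Definition spectrum (V : lmodType R) (B : V -> V) : set R :=
  [set a | ~ bijective (fun v => B v - a *: v)].

Definition condition_number (S : set R) (chi : R) : Prop :=
  exists lmax lmin : R,
    [/\ S lmax /\ (forall a, S a -> a <= lmax),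
        S lmin /\ 0 < lmin,
        (forall a, S a -> 0 < a -> lmin <= a)
      & lmax / lmin = chi].

Definition gossip_matrix n (E : rel 'I_n) (W : 'M[R]_n) : Prop :=
  [/\ W^T = W /\ (forall v : 'cV[R]_n, 0 <= (v^T *m W *m v) 0 0),
      (forall i j, (W i j != 0) = E i j || (i == j))
    & (forall v : 'cV[R]_n, W *m v = 0 <-> forall i j, v i 0 = v j 0)].

End Spectra.

(* The local variables live in l2, the case d = infinity: the instance below is
   fixed before the accuracy, and for finite d a linear span of vectors becomes
   stationary after finitely many steps. The operators map l2 to l2; constraints
   with values in R^p are embedded by padding with zeros. [cmatT] is the adjoint
   of [cmat], see [well_posed]. *)
Record problem (R : realType) := Problem {
  agents : nat;
  edge : rel 'I_agents;
  fobj : 'I_agents -> l2 R -> R;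
  cmat : 'I_agents -> {linear l2 R -> l2 R};
  cmatT : 'I_agents -> {linear l2 R -> l2 R};
  crhs : 'I_agents -> l2 R;
  xinit : 'I_agents -> l2 R }.

Section Problem.
Context {R : realType} (P : problem R).
Local Notation agent := 'I_(agents P).

Definition well_posed (LF muF : R) : Prop :=
  [/\ forall i : agent, smooth LF (fobj i) /\ strongly_convex muF (fobj i),
      forall i : agent, continuous (cmat i) /\
        (forall x y, dot (cmat i x) y = dot x (cmatT i y))
    & symmetric (@edge _ P) /\ irreflexive (@edge _ P)].

Definition feasible (x : agent -> l2 R) : Prop :=
  (forall i, cmat i (x i) = crhs i) /\ (forall i j, x i = x j).

Definition is_solution (x : agent -> l2 R) : Prop :=
  feasible x /\
  forall y, feasible y -> \sum_i fobj i (x i) <= \sum_i fobj i (y i).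

(* The operator A^T A for the block-diagonal A = diag(A_1, ..., A_n). *)
Definition gram (x : {ffun agent -> l2 R}) : {ffun agent -> l2 R} :=
  [ffun i => cmatT i (cmat i (x i))].

(* In infinite dimension the spectrum of A^T A may exceed its eigenvalues. Both
   sets are required to have condition number [chi]; since the spectrum contains
   the eigenvalues, this forces their extreme elements to coincide. *)
Definition gram_condition_number (chi : R) : Prop :=
  condition_number (point_spectrum gram) chi /\
  condition_number (spectrum gram) chi.

End Problem.

Inductive action := LocalComputation | Communication | Multiplication.

Definition action_eqb (a a' : action) : bool :=
  match a, a' with
  | LocalComputation, LocalComputation
  | Communication, Communication
  | Multiplication, Multiplication => true
  | _, _ => false
  end.

Lemma action_eqP : Equality.axiom action_eqb.
Proof. by case; case; constructor. Qed.

HB.instance Definition _ := hasDecEq.Build action action_eqP.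

Section Algorithms.
Context {R : realType}.

Definition span (V : lmodType R) (S : set V) : set V :=
  [set v | exists (m : nat) (c : 'I_m -> R) (u : 'I_m -> V),
    (forall k, S (u k)) /\ v = \sum_k c k *: u k].

Context (P : problem R).
Local Notation agent := 'I_(agents P).
Local Notation memories := (agent -> set (l2 R)).

Definition generators (a : action) (M : memories) (i : agent) : set (l2 R) :=
  match a with
  | LocalComputation =>
      [set v | exists2 x, M i x &
        [\/ v = x, gradient (fobj i) x v | gradient (fenchel (fobj i)) x v]]
  | Communication => [set v | exists2 j, edge i j & M j v]
  | Multiplication =>
      [set v | v = crhs i \/ exists2 x, M i x & v = cmatT i (cmat i x)]
  end.

(* [generators] discards the vectors held by agent [i] after a communication or
   a multiplication, and offers [crhs i] rather than its image under the adjoint.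
   Read rigidly, this forbids x - W x and x - A^T (A x - b), and instances on
   which no algorithm at all converges are easy to find. An algorithm may thus
   also use, at any step it likes, the vectors below. *)
Definition retained (a : action) (M : memories) (i : agent) : set (l2 R) :=
  M i `|` [set v | a = Multiplication /\ v = cmatT i (crhs i)].

(* Memories after the first [k] actions. *)
Fixpoint memory (act : nat -> action) (keep : nat -> bool) (k : nat) : memories :=
  if k is k'.+1 then
    let M := memory act keep k' in
    fun i => span (generators (act k') M i `|`
                   (if keep k' then retained (act k') M i else set0))
  else fun i => [set xinit i].

End Algorithms.

Record algorithm (R : realType) (P : problem R) := Algorithm {
  act : nat -> action;
  keep : nat -> bool;
  output : nat -> 'I_(agents P) -> l2 R;
  outputP : forall k i, memory act keep k i (output k i) }.

Definition action_count (R : realType) (P : problem R) (alg : algorithm P)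
  (a : action) (k : nat) : nat := count_mem a (mkseq (act alg) k).

Definition accurate (R : realType) (P : problem R) (alg : algorithm P)
  (xs : l2 R) (eps : R) (k : nat) : Prop :=
  forall i, `|output alg k i - xs| ^+ 2 <= eps.

Definition theta_bounds (R : realType) (c C g N : R) : Prop :=
  c * g <= N <= C * g.

(* Main.v *)
Require Import Defs.
From HB Require Import structures.
From mathcomp Require Import all_boot all_order all_algebra.
From mathcomp Require Import all_classical all_reals all_analysis.
From mathcomp Require Import ring lra zify.
Set Implicit Arguments.
Unset Strict Implicit.
Unset Printing Implicit Defensive.
Import Order.TTheory GRing.Theory Num.Theory numFieldNormedType.Exports.
Local Open Scope classical_set_scope.
Local Open Scope ring_scope.

(** The hard problem is a quadratic over [l2] whose coordinates are cut into
    blocks of equal length. Block [j] holds copies of one scalar [y_j], and the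
    affine constraints say that the copies in a block agree. The agents, and
    likewise the copies inside a block, sit on a line of [n = 3 m - 1] positions
    with two of them at each position. The first [m] positions form the head
    of the line and the last [m] its tail, so that head and tail are [m] steps
    apart. The matrix [gossip] of such a line has any prescribed condition number
    [chi >= 1], and [m] can be taken at least [sqrt chi / 6] ([chain_length],
    [gossip_condition_number]). It is used twice: as the gossip matrix for
    [chiW], and, block by block, as the matrix [A^T A] for [chiA], with lengths
    [m] and [m'].

    Agents at the head couple [y_(2j)] with [y_(2j+1)] through the copies at the
    head; agents at the tail couple [y_(2j+1)] with [y_(2j+2)] through the copies
    at the tail. On the constraint set the total objective is therefore the
    tridiagonal function of Nesterov's lower bound, with a linear term in [y_0]
    only. Its minimiser is [y_j = q ^ j] with [1 - q] at most of order
    [sqrt (mu / L)] ([ratio_exists], [solution_is_solution], [gap_le]).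

    Each Hessian is [a + b P] with [P] an involution of the coordinates, and its
    inverse has the same form. Gradients of [f_i] and of its conjugate thus
    enlarge the support of a vector at most by its image under that involution.
    All memories start at zero. For [y_(j+1)] to become nonzero, the information
    must be at one end of both lines, and for [y_(j+2)] at the opposite end of
    both: one more block costs at least one local computation, [m]
    communications and [m'] multiplications ([zigzag], [supported_memory]). An
    output with error [eps] must be nonzero up to a block of order
    [sqrt (L / mu) * ln (1 / eps)] ([unreachable_error], [decay_bound]), and the
    three lower bounds follow together. *)

(** * Square-summable sequences and coordinate involutions *)

Section Coordinates.
Context {R : realType}.
Implicit Types x y : l2 R.

Lemma l2_add x y k : (x + y) k = x k + y k.
Proof. by []. Qed.

Lemma l2_scale a x k : (a *: x) k = a * x k.
Proof. by []. Qed.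

Lemma l2_opp x k : (- x) k = - x k.
Proof. by []. Qed.

Lemma l2_zero k : (0 : l2 R) k = 0.
Proof. by []. Qed.

Lemma l2_sum (I : Type) (r : seq I) (F : I -> l2 R) k :
  (\sum_(i <- r) F i) k = \sum_(i <- r) F i k.
Proof. by elim/big_rec2: _ => // i a y _ <-. Qed.

Lemma l2_ext x y : (forall k, x k = y k) -> x = y.
Proof. by move=> xy; apply/val_inj/funext. Qed.

End Coordinates.

Section SquareSummable.
Context {R : realType}.
Implicit Types x y : l2 R.

(** Sums over arbitrary finite sets of indices, not only initial segments, are
    what makes coordinate permutations manageable. *)
Lemma finite_sum_le_dot x (s : seq nat) :
  uniq s -> \sum_(k <- s) x k ^+ 2 <= dot x x.
Proof.
move=> us; pose L := (\max_(k <- s) k).+1.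
have sL k : k \in s -> (k < L)%N.
  by move=> ks; rewrite ltnS; exact: leq_bigmax_seq.
apply: (@le_trans _ _ (\sum_(0 <= k < L) x k ^+ 2)); last first.
  apply: (@le_trans _ _ (series (fun k => x k * x k) L)).
    by rewrite /series /= ler_sum.
  apply: nondecreasing_cvgn_le; last exact: dot_cvg.
  apply: nondecreasing_series => k _ _; exact: sqr_ge0.
rewrite [leRHS](bigID (fun k => k \in s)) /=.
apply: ler_wpDr; first by apply: sumr_ge0 => k _; exact: sqr_ge0.
rewrite -[leRHS]big_filter le_eqVlt; apply/orP; left; apply/eqP.
apply/perm_big/uniq_perm => //.
  by rewrite filter_uniq // iota_uniq.
move=> k; rewrite mem_filter mem_index_iota.
by case: (boolP (k \in s)) => //= /sL ->.
Qed.

Lemma bounded_partial_sums (u : nat -> R) C :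
  (forall K, exists2 K', (K <= K')%N & \sum_(0 <= k < K') u k ^+ 2 <= C) ->
  forall K, series (fun k => u k ^+ 2) K <= C.
Proof.
move=> uC K; have [K' KK' /(le_trans _)] := uC K; apply.
rewrite /series /= [leRHS](@big_cat_nat _ _ _ K) //= lerDl.
by apply: sumr_ge0 => k _; exact: sqr_ge0.
Qed.

(** The partial sums need only be bounded along cofinally many [K'], such as the
    multiples of a block length. *)
Lemma square_summable_bounded (u : nat -> R) C :
  (forall K, exists2 K', (K <= K')%N & \sum_(0 <= k < K') u k ^+ 2 <= C) ->
  u \in square_summable.
Proof.
move=> /bounded_partial_sums uC; apply/square_summableP.
apply: nondecreasing_is_cvgn.
  by apply: nondecreasing_series => k _ _; exact: sqr_ge0.
by exists C => _ [K _ <-]; exact: uC.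
Qed.

Lemma dot_bounded x C :
  (forall K, exists2 K', (K <= K')%N & \sum_(0 <= k < K') x k ^+ 2 <= C) ->
  dot x x <= C.
Proof.
move=> /bounded_partial_sums xC; apply: limr_le; first exact: dot_cvg.
by apply: nearW => K; exact: xC.
Qed.

Lemma dot_cvg_blocks x y B : (0 < B)%N ->
  \sum_(0 <= k < J * B) x k * y k @[J --> \oo] --> dot x y.
Proof.
move=> B0; have cB : (J * B)%N @[J --> \oo] --> \oo.
  apply/cvgnyPge => A; near=> J; apply: (@leq_trans J); last exact: leq_pmulr.
  by near: J; exact: nbhs_infty_ge.
have := @cvg_comp _ _ _ (fun J => J * B)%N (series (fun k => x k * y k)) \oo \oo.
by move=> /(_ (nbhs (dot x y)) cB); apply; exact: (@dot_cvg _ x y).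
Unshelve. all: by end_near. Qed.

Lemma dot_eq_blocks x y x' y' B : (0 < B)%N ->
  (forall J, \sum_(0 <= k < J * B) x k * y k = \sum_(0 <= k < J * B) x' k * y' k) ->
  dot x y = dot x' y'.
Proof.
move=> B0 e; have := @dot_cvg_blocks x y B B0.
under eq_fun do rewrite e; move=> h.
have h' := @dot_cvg_blocks x' y' B B0.
by rewrite -(cvg_lim (@norm_hausdorff _ _) h) (cvg_lim (@norm_hausdorff _ _) h').
Qed.

Lemma big_blocks (F : nat -> R) J B :
  \sum_(0 <= k < J * B) F k = \sum_(j < J) \sum_(c < B) F (j * B + c)%N.
Proof.
elim: J => [|J IH]; first by rewrite mul0n big_geq // big_ord0.
rewrite (@big_cat_nat _ _ _ (J * B)) //=; last by rewrite leq_mul2r leqnSn orbT.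
rewrite IH big_ord_recr /=; congr (_ + _).
rewrite -{1}[(J * B)%N]add0n big_addn mulSn addnK big_mkord.
by apply: eq_bigr => c _; rewrite addnC.
Qed.

Lemma dotNr x y : dot x (- y) = - dot x y.
Proof. by rewrite -scaleN1r dotZr mulN1r. Qed.

Lemma dotNl x y : dot (- x) y = - dot x y.
Proof. by rewrite dotC dotNr dotC. Qed.

Lemma sqr_l2_norm x : `|x| ^+ 2 = dot x x.
Proof. by rewrite l2_normE sqr_sqrtr // dot_ge0. Qed.

Lemma norm_dot_le x y : `|dot x y| <= `|x| * `|y|.
Proof.
rewrite -ler_sqr ?nnegrE ?mulr_ge0 //.
by rewrite exprMn !sqr_l2_norm real_normK ?num_real // dot_cauchy_schwarz.
Qed.

Lemma le_sqr_norm x y : dot x x <= dot y y -> `|x| <= `|y|.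
Proof. by move=> h; rewrite -ler_sqr ?nnegrE // !sqr_l2_norm. Qed.

End SquareSummable.

Section Reindexing.
Context {R : realType} (s : nat -> nat) (sK : involutive s).
Implicit Types x y : l2 R.

Lemma sum_reindex_le x K : \sum_(0 <= k < K) x (s k) ^+ 2 <= dot x x.
Proof.
rewrite -(big_map s xpredT (fun k => x k ^+ 2)); apply: finite_sum_le_dot.
by rewrite map_inj_uniq ?iota_uniq //; exact: inv_inj sK.
Qed.

Lemma reindex_subproof x : (fun k => x (s k)) \in square_summable.
Proof.
apply: (@square_summable_bounded _ _ (dot x x)) => K.
by exists K => //; exact: sum_reindex_le.
Qed.

(** Well defined because square sums are insensitive to the order of the
    coordinates. *)
Definition reindex x : l2 R := L2 (reindex_subproof x).

Lemma reindex_linear : linear reindex.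
Proof. by move=> a x y; apply/val_inj. Qed.

HB.instance Definition _ := GRing.isLinear.Build R (l2 R) (l2 R) *:%R reindex
  reindex_linear.

Lemma reindexK : involutive reindex.
Proof. by move=> x; apply/val_inj/funext => k /=; rewrite sK. Qed.

Lemma dot_reindex_le x : dot (reindex x) (reindex x) <= dot x x.
Proof. by apply: dot_bounded => K; exists K => //; exact: sum_reindex_le. Qed.

Lemma dot_reindex_diag x : dot (reindex x) (reindex x) = dot x x.
Proof.
apply/eqP; rewrite eq_le dot_reindex_le /=.
by rewrite -{1 2}[x]reindexK dot_reindex_le.
Qed.

(** Polarization of [dot_reindex_diag]. *)
Lemma dot_reindex2 x y : dot (reindex x) (reindex y) = dot x y.
Proof.
have := dot_reindex_diag (x + y); rewrite linearD /= !(dotDl, dotDr).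
rewrite !dot_reindex_diag (dotC (reindex y)) (dotC y).
by move=> h; lra.
Qed.

Lemma dot_reindex x y : dot (reindex x) y = dot x (reindex y).
Proof. by rewrite -[in LHS](reindexK y) dot_reindex2. Qed.

Lemma dot_reindex_self_le x : `|dot x (reindex x)| <= `|x| ^+ 2.
Proof.
rewrite (le_trans (norm_dot_le _ _)) // expr2 ler_wpM2l //.
by apply: le_sqr_norm; exact: dot_reindex_le.
Qed.

End Reindexing.

(** * Quadratic functions and their conjugates *)

Section Gradients.
Context {R : realType}.
Implicit Types (x y g : l2 R) (f : l2 R -> R).

Lemma dot_linear g : linear (dot g : l2 R -> R).
Proof. by move=> a x y; rewrite dotDr dotZr. Qed.

HB.instance Definition _ g := GRing.isLinear.Build R (l2 R) R *:%R (dot g)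
  (dot_linear g).

Lemma bounded_linear_continuous (V W : normedModType R) (T : {linear V -> W}) C :
  (forall v, `|T v| <= C * `|v|) -> continuous T.
Proof.
move=> TC; apply/linear_bounded_continuous; apply/linear_boundedP.
exists C; split; first exact: num_real.
by move=> M CM x; rewrite (le_trans (TC x)) // ler_wpM2r // ltW.
Qed.

Lemma dot_continuous g : continuous (dot g).
Proof.
by apply: (@bounded_linear_continuous _ _ _ `|g|) => x; exact: norm_dot_le.
Qed.

Lemma gradient_unique f x g g' : gradient f x g -> gradient f x g' -> g = g'.
Proof.
move=> [_ dg] [_ dg']; have e : dot g = dot g' by rewrite -dg -dg'.
apply/eqP; rewrite -subr_eq0; apply/eqP/dot_eq0.
by rewrite dotDl dotNl (congr1 (@^~ _) e) subrr.
Qed.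

(** A second-order error bound is how all gradients below are identified. *)
Lemma gradient_quadratic_error f x g C :
  (forall y, `|f y - f x - dot g (y - x)| <= C * `|y - x| ^+ 2) ->
  gradient f x g.
Proof.
move=> fC.
have E : f \o shift x = cst (f x) + dot g +o_ 0 id.
  apply/eqaddoP => e e0; near=> h.
  have -> : (f \o shift x - (cst (f x) + dot g)) h =
      f (h + x) - f x - dot g ((h + x) - x).
    by rewrite addrK -addrA -opprD.
  apply: le_trans (fC _) _; rewrite addrK expr2 mulrA ler_wpM2r //.
  apply: (@le_trans _ _ ((`|C| + 1) * `|h|)).
    by rewrite ler_wpM2r // (le_trans (ler_norm C)) // lerDl.
  rewrite mulrC -ler_pdivlMr ?ltr_wpDl //.
  near: h; apply: nbhs0_le; rewrite divr_gt0 // ltr_wpDl //.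
have D := diff_unique (@dot_continuous g) E.
split; last exact: D.
apply/diff_locallyP; rewrite D; split => //.
exact: dot_continuous.
Unshelve. all: by end_near. Qed.

End Gradients.

Section Quadratics.
Context {R : realType} (T : {linear l2 R -> l2 R}) (M : R) (h : l2 R) (c : R).
Hypothesis Tsym : forall x y, dot (T x) y = dot x (T y).
Hypothesis Tbounded : forall x, `|dot x (T x)| <= M * `|x| ^+ 2.

Definition quadratic (x : l2 R) : R := dot x (T x) / 2 - dot h x + c.

Lemma quadratic_expand x y : quadratic y =
  quadratic x + dot (T x - h) (y - x) + dot (y - x) (T (y - x)) / 2.
Proof.
rewrite -[y in LHS](subrK x); move: (y - x) => d; rewrite /quadratic.
rewrite linearD /= !(dotDl, dotDr, dotNl) !Tsym (dotC x (T d)) Tsym.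
by field.
Qed.

Lemma quadratic_gradient x : gradient quadratic x (T x - h).
Proof.
apply: (@gradient_quadratic_error _ _ _ _ (M / 2)) => y.
rewrite (quadratic_expand x y).
rewrite [X in `|X|](_ : _ = dot (y - x) (T (y - x)) / 2); last by ring.
rewrite normrM (ger0_norm (_ : 0 <= 2^-1)) ?invr_ge0 // mulrAC.
by rewrite ler_wpM2r ?invr_ge0.
Qed.

Lemma quadratic_gradientE x g : gradient quadratic x g -> g = T x - h.
Proof. by move=> xg; exact: gradient_unique xg (quadratic_gradient x). Qed.

Lemma quadratic_has_gradient : has_gradient quadratic.
Proof. by move=> x; exists (T x - h); exact: quadratic_gradient. Qed.

Lemma quadratic_smooth L : (forall x, dot x (T x) <= L * `|x| ^+ 2) ->
  smooth L quadratic.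
Proof.
move=> TL; split; first exact: quadratic_has_gradient.
move=> x g y /quadratic_gradientE ->.
rewrite (quadratic_expand x y) lerD2l mulrAC.
by rewrite ler_wpM2r ?invr_ge0.
Qed.

Lemma quadratic_strongly_convex mu :
  (forall x, mu * `|x| ^+ 2 <= dot x (T x)) -> strongly_convex mu quadratic.
Proof.
move=> Tmu; split; first exact: quadratic_has_gradient.
move=> x g y /quadratic_gradientE ->.
rewrite (quadratic_expand x y) lerD2l mulrAC.
by rewrite ler_wpM2r ?invr_ge0.
Qed.

End Quadratics.

(** Completing the square: [dot y x - f x] is its value at [x = S (y + h)] minus
    half the quadratic form of [T] at the distance to that point, so the supremum
    is attained and the conjugate is again quadratic, with Hessian [S]. *)
Lemma fenchel_quadratic (R : realType) (T S : {linear l2 R -> l2 R}) (h : l2 R) c :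
  (forall x y, dot (T x) y = dot x (T y)) -> (forall x, 0 <= dot x (T x)) ->
  cancel S T ->
  fenchel (quadratic T h c) =
    quadratic S (- S h) (dot h (S h) / 2 - c).
Proof.
move=> Tsym T0 ST; apply/funext => y.
have Ssym u v : dot (S u) v = dot u (S v).
  by rewrite -[v in LHS]ST -Tsym ST.
have top x : dot y x - quadratic T h c x =
    quadratic S (- S h) (dot h (S h) / 2 - c) y
    - dot (x - S (y + h)) (T (x - S (y + h))) / 2.
  rewrite -[x in LHS](subrK (S (y + h))); move: (x - S (y + h)) => z.
  rewrite /quadratic.
  rewrite !linearD /= !(dotDl, dotDr) -!Tsym ?linearD /= !ST ?(dotDl, dotDr) ?dotNl.
  rewrite (Tsym z (S y)) (Tsym z (S h)) !ST !Ssym (dotC z y) (dotC z h).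
  have -> : dot y (S h) = dot h (S y) by rewrite -Ssym dotC.
  by field.
rewrite /fenchel; apply/eqP; rewrite eq_le; apply/andP; split.
  apply: ge_sup; first by exists (dot y 0 - quadratic T h c 0); exists 0.
  by move=> _ [x _ <-]; rewrite top gerBl divr_ge0.
apply: ub_le_sup.
  exists (quadratic S (- S h) (dot h (S h) / 2 - c) y) => _ [x _ <-].
  by rewrite top gerBl divr_ge0.
by exists (S (y + h)) => //; rewrite top subrr dot0l mul0r subr0.
Qed.

(** * Block-diagonal operators and their spectra *)

Section Blocks.
Context {R : realType} (B : nat) (B_gt0 : (0 < B)%N).
Implicit Types (x y : l2 R) (M N : 'M[R]_B) (j k : nat).

Definition offset k : 'I_B := Ordinal (ltn_pmod k B_gt0).

Lemma block_of (j : nat) (c : 'I_B) : ((j * B + c) %/ B)%N = j.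
Proof. by rewrite divnMDl // divn_small // addn0. Qed.

Lemma offset_of (j : nat) (c : 'I_B) : offset (j * B + c)%N = c.
Proof. by apply/val_inj; rewrite /= modnMDl modn_small. Qed.

Definition block x j : 'cV[R]_B := \col_c x (j * B + c)%N.

Lemma block_at x k : x k = block x (k %/ B)%N (offset k) 0.
Proof. by rewrite mxE /= -divn_eq. Qed.

Lemma block_inj x y : block x =1 block y -> x = y.
Proof. by move=> e; apply/val_inj/funext => k /=; rewrite !block_at e. Qed.

Lemma blockD x y j : block (x + y) j = block x j + block y j.
Proof. by apply/matrixP => c d; rewrite !mxE. Qed.

Lemma blockZ a x j : block (a *: x) j = a *: block x j.
Proof. by apply/matrixP => c d; rewrite !mxE. Qed.

Lemma dot_blocks_eq x y x' y' :
  (forall j, (block x j)^T *m block y j = (block x' j)^T *m block y' j) ->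
  dot x y = dot x' y'.
Proof.
move=> e; apply: (dot_eq_blocks B_gt0) => J; rewrite !big_blocks.
apply: eq_bigr => j _; have /matrixP/(_ 0 0) := e j; rewrite !mxE.
by under eq_bigr do rewrite !mxE; under [RHS]eq_bigr do rewrite !mxE.
Qed.

(** A crude bound of the squared operator norm, by row sums of absolute values. *)
Definition mx_bound M : R := \sum_c (\sum_d `|M c d|) ^+ 2.

Lemma mx_bound_ge0 M : 0 <= mx_bound M.
Proof. by apply: sumr_ge0 => c _; exact: sqr_ge0. Qed.

Lemma mx_boundP M (v : 'cV[R]_B) :
  \sum_c (M *m v) c 0 ^+ 2 <= mx_bound M * \sum_c v c 0 ^+ 2.
Proof.
rewrite /mx_bound mulr_suml; apply: ler_sum => c _; rewrite mxE.
set V := \sum_c v c 0 ^+ 2; have V0 : 0 <= V by apply: sumr_ge0 => d _; exact: sqr_ge0.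
have vV d : `|v d 0| <= Num.sqrt V.
  rewrite -sqrtr_sqr ler_wsqrtr // /V (bigD1 d) //= lerDl.
  by apply: sumr_ge0 => e _; exact: sqr_ge0.
rewrite -(sqr_sqrtr V0) -exprMn -[leLHS]real_normK ?num_real // ler_sqr ?nnegrE //.
  apply: le_trans (ler_norm_sum _ _ _) _; rewrite mulr_suml.
  by apply: ler_sum => d _; rewrite normrM ler_wpM2l.
by rewrite mulr_ge0 ?sqrtr_ge0 // sumr_ge0.
Qed.

Definition blockseq M x k : R := (M *m block x (k %/ B)%N) (offset k) 0.

Lemma sum_blockseq_le M x K : exists2 K', (K <= K')%N &
  \sum_(0 <= k < K') blockseq M x k ^+ 2 <= mx_bound M * dot x x.
Proof.
exists (K * B)%N; first exact: leq_pmulr.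
rewrite big_blocks.
apply: (@le_trans _ _ (mx_bound M * \sum_(0 <= k < K * B) x k ^+ 2)).
  rewrite big_blocks mulr_sumr; apply: ler_sum => j _.
  have := mx_boundP M (block x j).
  under [X in _ <= _ * X]eq_bigr do rewrite mxE.
  by under [X in _ -> X <= _]eq_bigr do rewrite /blockseq block_of offset_of.
by rewrite ler_wpM2l ?mx_bound_ge0 // finite_sum_le_dot // iota_uniq.
Qed.

Lemma blockseq_summable M x : blockseq M x \in square_summable.
Proof. exact: square_summable_bounded (sum_blockseq_le M x). Qed.

Definition blockop M x : l2 R := L2 (blockseq_summable M x).

Lemma block_blockop M x j : block (blockop M x) j = M *m block x j.
Proof.
by apply/matrixP => c d; rewrite ord1 mxE /= /blockseq block_of offset_of.
Qed.

Lemma blockop_linear M : linear (blockop M).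
Proof.
move=> a x y; apply: block_inj => j.
by rewrite block_blockop !blockD !blockZ !block_blockop mulmxDr scalemxAr.
Qed.

HB.instance Definition _ M := GRing.isLinear.Build R (l2 R) (l2 R) *:%R
  (blockop M) (blockop_linear M).

Lemma blockop_continuous M : continuous (blockop M).
Proof.
apply: (@bounded_linear_continuous _ _ _ _ (Num.sqrt (mx_bound M))) => x.
rewrite !l2_normE -sqrtrM ?mx_bound_ge0 // ler_wsqrtr //.
exact: (@dot_bounded _ (blockop M x) _ (sum_blockseq_le M x)).
Qed.

Lemma dot_blockop M x y : dot (blockop M x) y = dot x (blockop M^T y).
Proof.
by apply: dot_blocks_eq => j; rewrite !block_blockop trmx_mul mulmxA.
Qed.

Lemma blockop_mul M N x : blockop M (blockop N x) = blockop (M *m N) x.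
Proof. by apply: block_inj => j; rewrite !block_blockop mulmxA. Qed.

Lemma blockop1 x : blockop 1%:M x = x.
Proof. by apply: block_inj => j; rewrite block_blockop mul1mx. Qed.

Lemma blockop_sub_scalar M a x : blockop (M - a%:M) x = blockop M x - a *: x.
Proof.
apply: block_inj => j; rewrite -scaleNr blockD blockZ !block_blockop.
by rewrite mulmxBl mul_scalar_mx scaleNr.
Qed.

Lemma embed_summable (v : 'cV[R]_B) :
  (fun k => if (k < B)%N then v (offset k) 0 else 0) \in square_summable.
Proof.
set u := (fun k => _).
apply: (@square_summable_bounded _ _ (\sum_(0 <= k < B) u k ^+ 2)) => K.
exists (maxn K B); first exact: leq_maxl.
rewrite (@big_cat_nat _ _ _ B) ?leq_maxr //= gerDl.
rewrite big_nat big1 // => k /andP[Bk _].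
by rewrite /u ltnNge Bk expr0n.
Qed.

Definition embed (v : 'cV[R]_B) : l2 R := L2 (embed_summable v).

Lemma block_embed v : block (embed v) 0 = v.
Proof.
by apply/matrixP => c d; rewrite ord1 mxE /= offset_of mul0n ltn_ord.
Qed.

Lemma blockop_embed M v : blockop M (embed v) = embed (M *m v).
Proof.
apply: block_inj => -[|j]; rewrite block_blockop ?block_embed //.
have e w : block (embed w) j.+1 = 0.
  apply/matrixP => c d; rewrite !mxE /= ifN // -leqNgt.
  by rewrite (leq_trans _ (leq_addr _ _)) // leq_pmull.
by rewrite !e mulmx0.
Qed.

End Blocks.

Section BlockSpectrum.
Context {R : realType} (B : nat) (B_gt0 : (0 < B)%N) (I : finType) (i0 : I).
Variable M : 'M[R]_B.
Hypothesis Msym : M^T = M.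

Definition diag_blockop (x : {ffun I -> l2 R}) : {ffun I -> l2 R} :=
  [ffun i => blockop B_gt0 M (x i)].

Lemma eigenvalue_col (a : R) : eigenvalue M a <->
  exists2 v : 'cV[R]_B, v != 0 & M *m v = a *: v.
Proof.
split=> [/eigenvalueP[v Mv v0]|[v v0 Mv]].
  exists v^T; first by rewrite trmx_eq0.
  by rewrite -{1}Msym -trmx_mul Mv linearZ.
apply/eigenvalueP; exists v^T; last by rewrite trmx_eq0.
by rewrite -{1}Msym -trmx_mul Mv linearZ.
Qed.

Lemma point_spectrum_diag_blockop :
  point_spectrum diag_blockop = [set a | eigenvalue M a].
Proof.
apply/seteqP; split=> a /=.
  move=> [x /eqP x0 /ffunP Mx]; apply/eigenvalue_col.
  have [i xi] : exists i, x i != 0.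
    apply/existsP; apply: contra_notT x0 => /existsPn x0; apply/ffunP => i.
    by have := x0 i; rewrite negbK ffunE => /eqP.
  have [j xj] : exists j, block B (x i) j != 0.
    apply: contrapT => n; move/eqP: xi; apply; apply: (block_inj B_gt0) => j.
    have -> : block B (0 : l2 R) j = 0 by apply/matrixP => c d; rewrite !mxE.
    by apply: contrapT => /eqP xj; apply: n; exists j.
  exists (block B (x i) j) => //; have := Mx i; rewrite !ffunE => Mxi.
  by rewrite -(block_blockop B_gt0) Mxi blockZ.
move=> /eigenvalue_col[v v0 Mv]; exists [ffun=> embed B_gt0 v].
  apply: contra_neq v0 => /ffunP/(_ i0); rewrite !ffunE => e.
  by rewrite -(block_embed B_gt0 v) e; apply/matrixP => c d; rewrite !mxE.
apply/ffunP => i; rewrite !ffunE blockop_embed Mv.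
apply/val_inj/funext => k /=; rewrite mxE.
rewrite [RHS](_ : _ = a * (if (k < B)%N then v (offset B_gt0 k) 0 else 0)) //.
by case: ifP => // _; rewrite mulr0.
Qed.

(** Beyond its eigenvalues, [M - a] is invertible, and the inverse matrix applied
    to every block inverts the operator. Hence in this infinite-dimensional
    setting nothing besides the eigenvalues enters the spectrum. *)
Lemma spectrum_diag_blockop :
  spectrum diag_blockop = [set a | eigenvalue M a].
Proof.
apply/seteqP; split=> a /=; last first.
  move=> Ma; have : point_spectrum diag_blockop a.
    by rewrite point_spectrum_diag_blockop.
  move=> [x x0 Mx] /bij_inj inj.
  move/eqP: x0; apply; apply: inj; rewrite Mx subrr scaler0 subr0.
  apply/esym/ffunP => i; rewrite !ffunE.
  exact: linear0.
apply: contra_notT; rewrite /eigenvalue negbK kermx_eq0 row_free_unit => u.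
pose inv := fun x : {ffun I -> l2 R} =>
  [ffun i => blockop B_gt0 (invmx (M - a%:M)) (x i)] : {ffun I -> l2 R}.
have E x : diag_blockop x - a *: x =
    [ffun i => blockop B_gt0 (M - a%:M) (x i)].
  by apply/ffunP => i; rewrite !ffunE blockop_sub_scalar.
exists inv => x; rewrite ?E; apply/ffunP => i; rewrite !ffunE blockop_mul.
  by rewrite mulVmx // blockop1.
by rewrite mulmxV // blockop1.
Qed.

End BlockSpectrum.

(** * The Laplacian of a weighted path *)

Section WeightedPath.
Context {R : realType} (n : nat).
Implicit Types (v : 'cV[R]_n) (a : R).

(** The weight of the edge between positions [c - 1] and [c]. Being a concave
    quadratic with second difference [-2] it makes the smallest positive
    eigenvalue of the path exactly [2], and vanishing at [0] and [n] it takes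
    care of both ends of the path. *)
Definition weight (c : nat) : R := (c * (n - c))%:R.

Lemma weight_ge0 c : 0 <= weight c.
Proof. exact: ler0n. Qed.

Lemma weight0 : weight 0 = 0.
Proof. by rewrite /weight mul0n. Qed.

Lemma weightn : weight n = 0.
Proof. by rewrite /weight subnn muln0. Qed.

Lemma weight_gt0 c : (0 < c < n)%N -> 0 < weight c.
Proof. by move=> /andP[c0 cn]; rewrite ltr0n muln_gt0 c0 subn_gt0. Qed.

Lemma weight_concave c : (c.+1 < n)%N ->
  weight c.+1 *+ 2 - weight c - weight c.+2 = 2.
Proof.
move=> cn; rewrite /weight !natrM !natrB ?(ltnW cn) //; last by lia.
by rewrite -[c.+2]addn2 -[c.+1]addn1 !natrD; ring.
Qed.

Definition degree (c : nat) : R := weight c + weight c.+1.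

Lemma degree_gt0 c : (1 < n)%N -> (c < n)%N -> 0 < degree c.
Proof.
case: c => [|c] n1 cn; first by rewrite /degree weight0 add0r weight_gt0.
by rewrite /degree ltr_pwDl ?weight_ge0 // weight_gt0.
Qed.

Definition incidence : 'M[R]_n := \matrix_(e, c)
  (Num.sqrt (weight e.+1) * ((c == e.+1 :> nat)%:R - (c == e)%:R)).

(** The entries of a vector as a function on all naturals, zero out of range, so
    that neighbours of the end positions can be written down. *)
Definition extend v (k : nat) : R := \sum_c v c 0 * (c == k :> nat)%:R.

Lemma extend_ord v (c : 'I_n) : extend v c = v c 0.
Proof.
rewrite /extend (bigD1 c) //= eqxx mulr1 big1 ?addr0 // => d dc.
by rewrite (negbTE (_ : (d : nat) != c)) ?mulr0.
Qed.

(** The last row vanishes because [weight n = 0], which is why a square matrix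
    can serve as the incidence matrix of a path. *)
Lemma incidence_mul v e :
  (incidence *m v) e 0 =
  Num.sqrt (weight e.+1) * (extend v e.+1 - extend v e).
Proof.
rewrite mxE /extend -sumrB mulr_sumr; apply: eq_bigr => c _; rewrite mxE.
by ring.
Qed.

Lemma sum_incidence (X : nat -> R) (p : 'I_n) :
  \sum_(e < n) weight e.+1 * ((p == e.+1 :> nat)%:R - (p == e)%:R) * X e =
  weight p * X p.-1 - weight p.+1 * X p.
Proof.
under eq_bigr do rewrite mulrBr mulrBl; rewrite sumrB; congr (_ - _); last first.
  rewrite (bigD1 p) //= eqxx mulr1 big1 ?addr0 // => e ep.
  by rewrite eq_sym (negbTE ep) mulr0 mul0r.
case: p => -[|p] pn /=.
  by rewrite weight0 mul0r big1 // => e _; rewrite mulr0 mul0r.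
rewrite (bigD1 (Ordinal (ltnW pn))) //= eqxx mulr1 big1 ?addr0 // => e ep.
rewrite eqSS [p == _](_ : _ = false) ?mulr0 ?mul0r //.
by apply: contraNF ep => /eqP pe; apply/eqP/val_inj.
Qed.

Definition path_laplacian : 'M[R]_n := incidence^T *m incidence.

Lemma path_laplacian_mul v p : (path_laplacian *m v) p 0 =
  weight p * (extend v p - extend v p.-1)
  - weight p.+1 * (extend v p.+1 - extend v p).
Proof.
rewrite -mulmxA mxE.
under eq_bigr => e _ do rewrite incidence_mul mxE mxE mulrACA -expr2
  sqr_sqrtr ?weight_ge0 // mulrA.
rewrite (sum_incidence (fun e => extend v e.+1 - extend v e)).
by case: p => -[|p] pn //=; rewrite weight0 !mul0r.
Qed.

Lemma path_laplacianE p q : path_laplacian p q =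
  weight p * ((q == p)%:R - (q.+1 == p :> nat)%:R)
  - weight p.+1 * ((q == p.+1 :> nat)%:R - (q == p)%:R).
Proof.
rewrite mxE.
under eq_bigr => e _ do rewrite !mxE mulrACA -expr2
  sqr_sqrtr ?weight_ge0 // mulrA.
rewrite (sum_incidence (fun e => (q == e.+1 :> nat)%:R - (q == e :> nat)%:R)).
by case: p => -[|p] pn //=; rewrite weight0 !mul0r.
Qed.

Lemma path_laplacian_diag p : path_laplacian p p = degree p.
Proof.
rewrite path_laplacianE eqxx gtn_eqF // ltn_eqF //.
by rewrite /degree /=; ring.
Qed.

Lemma path_laplacian_neq0 p q : p != q ->
  (path_laplacian p q != 0) = (p <= q.+1)%N && (q <= p.+1)%N.
Proof.
move=> pq; rewrite path_laplacianE.
have pq' : (p : nat) != q by [].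
rewrite -(inj_eq val_inj) /= (eq_sym (q : nat)) (negbTE pq').
have [e|qp] := eqVneq q.+1 (p : nat).
  rewrite [X in _ = X](_ : _ = true); last by lia.
  rewrite [q == p.+1 :> nat](_ : _ = false) /=; last by lia.
  rewrite !(subr0, sub0r, mulr0) mulrN1 oppr_eq0 gt_eqF //.
  by apply: weight_gt0; rewrite ltn_ord; lia.
have [e|qp'] := eqVneq (q : nat) p.+1.
  rewrite [X in _ = X](_ : _ = true); last by lia.
  rewrite /= !(subr0, sub0r, mulr0, mulr1) oppr_eq0 gt_eqF //.
  by apply: weight_gt0; have := ltn_ord q; lia.
rewrite /= subrr !mulr0 subrr eqxx; apply/esym/negbTE; lia.
Qed.

Lemma incidence_const v : incidence *m v = 0 <-> forall i j, v i 0 = v j 0.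
Proof.
split=> [/matrixP Dv|vc].
  have step k : (k.+1 < n)%N -> extend v k.+1 = extend v k.
    move=> kn; have := Dv (Ordinal (ltnW kn)) 0.
    rewrite incidence_mul mxE /= => /eqP.
    rewrite mulf_eq0 sqrtr_eq0 leNgt weight_gt0 ?kn //= subr_eq0.
    by move/eqP.
  have v0 (k : nat) : (k < n)%N -> extend v k = extend v 0.
    by elim: k => // k IH kn; rewrite step // IH // ltnW.
  by move=> i j; rewrite -!extend_ord !v0.
apply/matrixP => e c; rewrite ord1 incidence_mul mxE.
have [en|en] := ltnP e.+1 n.
  by rewrite -[e.+1]/(val (Ordinal en)) !extend_ord (vc _ e) subrr mulr0.
rewrite (_ : e.+1 = n) ?weightn ?sqrtr0 ?mul0r //.
by apply/eqP; rewrite eqn_leq en ltn_ord.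
Qed.

(** Evaluate the eigenvalue equation where [v] is largest in absolute value. *)
Lemma path_eigenvalue_le v a D : v != 0 -> path_laplacian *m v = a *: v ->
  (forall p, (p < n)%N -> degree p <= D) -> a <= 2 * D.
Proof.
move=> v0 Lv dD.
have [p0 vp0] : exists p, v p 0 != 0.
  apply/existsP; apply: contra_neqT v0 => /existsPn v0; apply/matrixP => p q.
  by rewrite ord1 mxE; apply/eqP; have := v0 p; rewrite negbK.
pose p := [arg max_(i > p0) `|v i 0|]%O.
have pmax i : `|v i 0| <= `|v p 0|.
  by rewrite /p; case: arg_maxP => // j _; apply.
have vp : 0 < `|v p 0|.
  by apply: lt_le_trans (pmax p0); rewrite normr_gt0.
have Vmax k : `|extend v k| <= `|v p 0|.
  have [kn|kn] := ltnP k n; first by rewrite -[k]/(val (Ordinal kn)) extend_ord.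
  rewrite /extend big1 ?normr0 // => c _.
  by rewrite ltn_eqF ?mulr0 // (leq_trans (ltn_ord c)).
rewrite -(ler_pM2r vp); apply: le_trans (ler_wpM2r (ltW vp) (ler_norm a)) _.
have := path_laplacian_mul v p; rewrite Lv mxE extend_ord => av.
rewrite -normrM av; apply: le_trans (ler_normB _ _) _.
rewrite !normrM !(ger0_norm (weight_ge0 _)).
have d1 : `|v p 0 - extend v p.-1| <= 2 * `|v p 0|.
  by rewrite mulr_natl mulr2n (le_trans (ler_normB _ _)) // lerD2l.
have d2 : `|extend v p.+1 - v p 0| <= 2 * `|v p 0|.
  by rewrite mulr_natl mulr2n (le_trans (ler_normB _ _)) // lerD2r.
have := dD p (ltn_ord p); rewrite /degree => dp.
have w0 := weight_ge0 p; have w1 := weight_ge0 p.+1.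
have := ler_wpM2l w0 d1; have := ler_wpM2l w1 d2; have := ler_wpM2r (ltW vp) dp.
by lra.
Qed.

(** The increments [u] of an eigenvector satisfy
    [a u_e = 2 w_(e+1) u_e - w_(e+2) u_(e+1) - w_e u_(e-1)]. Where [u] is largest in
    absolute value, the right-hand side is at least [2 w_(e+1) - w_(e+2) - w_e = 2]
    times [u_e] in its direction. *)
Lemma path_eigenvalue_ge v a : v != 0 -> path_laplacian *m v = a *: v ->
  0 < a -> 2 <= a.
Proof.
move=> v0 Lv a0.
pose u (e : nat) := if (e.+1 < n)%N then extend v e.+1 - extend v e else 0.
have [e0 ue0] : exists e : 'I_n, u e != 0.
  apply/existsP; apply: contra_neqT v0 => /existsPn u0.
  have Dv : incidence *m v = 0.
    apply/matrixP => e c; rewrite ord1 incidence_mul mxE.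
    have := u0 e; rewrite negbK /u; case: ltnP => [_ /eqP ->|en _].
      by rewrite mulr0.
    rewrite (_ : e.+1 = n) ?weightn ?sqrtr0 ?mul0r //.
    by apply/eqP; rewrite eqn_leq en ltn_ord.
  move: Lv; rewrite -mulmxA Dv mulmx0 => /esym/eqP.
  by rewrite scaler_eq0 gt_eqF //= => /eqP.
pose e := [arg max_(i > e0) `|u i|]%O.
have emax (i : nat) : (i < n)%N -> `|u i| <= `|u e|.
  move=> ni; rewrite -[i]/(val (Ordinal ni)) /e.
  by case: arg_maxP => // j _; apply.
have ue : 0 < `|u e| by apply: lt_le_trans (emax e0 _); rewrite ?normr_gt0.
have en : (e.+1 < n)%N.
  by move: ue; rewrite /u; case: ifP => //; rewrite normr0 ltxx.
have uE k : (k.+1 < n)%N -> extend v k.+1 - extend v k = u k.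
  by rewrite /u => ->.
have row k (kn : (k < n)%N) :
    a * extend v k = weight k * u k.-1 - weight k.+1 * u k.
  have := path_laplacian_mul v (Ordinal kn).
  rewrite Lv mxE -extend_ord /= => ->; congr (_ - _).
    case: k kn => [|k] kn; first by rewrite weight0 !mul0r.
    by rewrite uE.
  rewrite /u; case: ltnP => // nk.
  by rewrite (_ : k.+1 = n) ?weightn ?mul0r //; apply/eqP; rewrite eqn_leq nk kn.
have E : a * u e = weight e.+1 * u e *+ 2 - weight e.+2 * u e.+1 - weight e * u e.-1.
  by rewrite -uE // mulrBr !row ?(ltnW en) //= !uE // mulr2n; ring.
have le2 i : (i < n)%N -> u i * u e <= u e ^+ 2.
  move=> ni; apply: le_trans (ler_norm _) _.
  rewrite normrM -[u e ^+ 2]real_normK ?num_real // expr2 ler_wpM2r //.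
  exact: emax.
have u2 : 0 < u e ^+ 2 by rewrite -real_normK ?num_real // exprn_gt0.
rewrite -(ler_pM2r u2).
have -> : a * u e ^+ 2 = a * u e * u e by rewrite expr2 mulrA.
rewrite E -(weight_concave en).
have h1 := ler_wpM2l (weight_ge0 e.+2) (le2 e.+1 en).
have h2 := ler_wpM2l (weight_ge0 e) (le2 e.-1 (leq_ltn_trans (leq_pred _) (ltn_ord e))).
by rewrite !mulr2n; nra.
Qed.

(** The eigenvector of eigenvalue [2]: its increments are constant. *)
Definition linear_profile : 'cV[R]_n := \col_c (c%:R *+ 2 - (n.-1)%:R).

Lemma path_laplacian_linear_profile :
  path_laplacian *m linear_profile = 2 *: linear_profile.
Proof.
apply/matrixP => p c; rewrite ord1 path_laplacian_mul [RHS]mxE.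
have E k : (k < n)%N -> extend linear_profile k = k%:R *+ 2 - (n.-1)%:R.
  by move=> kn; rewrite -[k in LHS]/(val (Ordinal kn)) extend_ord mxE.
have -> : weight p * (extend linear_profile p - extend linear_profile p.-1) =
    weight p * 2.
  case: p => -[|p] pn /=; first by rewrite weight0 !mul0r.
  by rewrite !E ?(ltnW pn) // -[p.+1]addn1 natrD mulr2n; congr (_ * _); ring.
have -> : weight p.+1 * (extend linear_profile p.+1 - extend linear_profile p) =
    weight p.+1 * 2.
  have [pn|pn] := ltnP p.+1 n.
    by rewrite !E // -[p.+1]addn1 natrD; congr (_ * _); ring.
  rewrite (_ : p.+1 = n) ?weightn ?mul0r //.
  by apply/eqP; rewrite eqn_leq pn ltn_ord.
rewrite mxE /weight; case: n p {E} => [[]//|k] p.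
have pk : (p <= k)%N by rewrite -ltnS ltn_ord.
rewrite subSS subSn // !natrM natrB //=.
by rewrite -[(k - p).+1]addn1 natrD natrB // -[p.+1]addn1 !natrD; ring.
Qed.

Lemma linear_profile_neq0 : (1 < n)%N -> linear_profile != 0.
Proof.
move=> n1; apply/eqP => /matrixP/(_ (Ordinal (ltnW n1)) 0)/eqP.
rewrite !mxE /= mul0rn sub0r oppr_eq0 pnatr_eq0; lia.
Qed.

End WeightedPath.

(** * A gossip matrix of given condition number and large diameter *)

Section TwoLayers.
Context {R : realType} (n : nat) (chi : R).
Hypotheses (n_gt1 : (1 < n)%N) (chi_ge1 : 1 <= chi).
Hypothesis degree_le : forall p, (p < n)%N -> degree n p <= chi.
Local Notation D := (@incidence R n).
Local Notation L := (@path_laplacian R n).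

(** Two layers of the path. Vectors equal on both layers see the path Laplacian
    [L]; vectors opposite on the two layers are multiplied by [2 * chi]. The
    second part fixes the largest eigenvalue at will, without a formula for the
    spectrum of [L]. *)
Definition gossip_factor : 'M[R]_(n + n) :=
  block_mx (Num.sqrt 2^-1 *: D) (Num.sqrt 2^-1 *: D)
           ((Num.sqrt chi)%:M) (- (Num.sqrt chi)%:M).

Definition gossip : 'M[R]_(n + n) := gossip_factor^T *m gossip_factor.

Lemma gossip_sym : gossip^T = gossip.
Proof. by rewrite /gossip trmx_mul trmxK. Qed.

Lemma chi_ge0 : 0 <= chi.
Proof. exact: le_trans ler01 chi_ge1. Qed.

Lemma gossipE : gossip =
  block_mx (2^-1 *: L + chi%:M) (2^-1 *: L - chi%:M)
           (2^-1 *: L - chi%:M) (2^-1 *: L + chi%:M).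
Proof.
have sL : (Num.sqrt 2^-1 *: D)^T *m (Num.sqrt 2^-1 *: D) = 2^-1 *: L.
  rewrite [_^T]linearZ /= -scalemxAl -scalemxAr scalerA -expr2.
  by rewrite sqr_sqrtr ?invr_ge0.
have ss : (Num.sqrt chi)%:M *m (Num.sqrt chi)%:M = chi%:M :> 'M[R]_n.
  by rewrite -scalar_mxM -expr2 sqr_sqrtr // chi_ge0.
rewrite /gossip /gossip_factor tr_block_mx [(- _)^T]linearN /= tr_scalar_mx mulmx_block !sL.
by rewrite !(mulmxN, mulNmx) ss opprK.
Qed.

Lemma gossip_col (x y : 'cV[R]_n) : gossip *m col_mx x y =
  col_mx (2^-1 *: (L *m (x + y)) + chi *: (x - y))
         (2^-1 *: (L *m (x + y)) - chi *: (x - y)).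
Proof.
rewrite gossipE mul_block_col !(mulmxDl, mulNmx, mul_scalar_mx).
rewrite -!scalemxAl mulmxDr !scalerDr !scalerN; congr col_mx.
  by rewrite addrACA.
by rewrite opprB addrACA [- _ + _]addrC.
Qed.

Definition position (i : 'I_(n + n)) : nat :=
  match fintype.split i with inl p => p | inr p => p end.

Lemma position_lshift p : position (lshift n p) = p.
Proof. by rewrite /position (unsplitK (inl p)). Qed.

Lemma position_rshift p : position (rshift n p) = p.
Proof. by rewrite /position (unsplitK (inr p)). Qed.

Definition adjacent : rel 'I_(n + n) := fun i j =>
  [&& i != j, (position i <= (position j).+1)%N
    & (position j <= (position i).+1)%N].

Lemma adjacent_sym : symmetric adjacent.
Proof. by move=> i j; rewrite /adjacent eq_sym andbC -andbA andbCA andbA andbC. Qed.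

Lemma adjacent_irreflexive : irreflexive adjacent.
Proof. by move=> i; rewrite /adjacent eqxx. Qed.

(** Opposite copies at one position are joined with weight [chi - degree / 2], so
    [degree <= chi] keeps this entry nonzero. *)
Lemma gossip_neq0 i j : (gossip i j != 0) = adjacent i j || (i == j).
Proof.
have dh (p : 'I_n) : 0 < 2^-1 * L p p <= 2^-1 * chi.
  rewrite path_laplacian_diag pmulr_rgt0 ?invr_gt0 // degree_gt0 //=.
  by rewrite ler_wpM2l ?invr_ge0 // degree_le.
have ch : 0 < chi by exact: lt_le_trans ltr01 chi_ge1.
have off (p q : 'I_n) s : p != q ->
    (2^-1 * L p q + s * (chi *+ (p == q)) != 0) =
    (p <= q.+1)%N && (q <= p.+1)%N.
  move=> pq; rewrite (negbTE pq) mulr0n mulr0 addr0 mulf_eq0 invr_eq0.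
  by rewrite pnatr_eq0 /= path_laplacian_neq0.
rewrite gossipE; move: (L) dh off => l dh off; rewrite /adjacent -(splitK i) -(splitK j).
case: (fintype.split i) => p; case: (fintype.split j) => q /=;
  rewrite ?position_lshift ?position_rshift
  ?(block_mxEul, block_mxEur, block_mxEdl, block_mxEdr) !mxE.
- rewrite eq_lshift; have [->|pq] := eqVneq p q.
    by rewrite mulr1n gt_eqF // addr_gt0 //; have /andP[] := dh q.
  by have := off p q 1 pq; rewrite mul1r (negbTE pq) => ->; rewrite orbF.
- rewrite eq_lrshift orbF /=; have [->|pq] := eqVneq p q.
    rewrite leqnSn mulr1n lt_eqF //; have /andP[_ h] := dh q.
    by apply: le_lt_trans (lerB h (lexx _)) _; lra.
  by have := off p q (-1) pq; rewrite mulN1r (negbTE pq) => ->.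
- rewrite eq_rlshift orbF /=; have [->|pq] := eqVneq p q.
    rewrite leqnSn mulr1n lt_eqF //; have /andP[_ h] := dh q.
    by apply: le_lt_trans (lerB h (lexx _)) _; lra.
  by have := off p q (-1) pq; rewrite mulN1r (negbTE pq) => ->.
- rewrite eq_rshift; have [->|pq] := eqVneq p q.
    by rewrite mulr1n gt_eqF // addr_gt0 //; have /andP[] := dh q.
  by have := off p q 1 pq; rewrite mul1r (negbTE pq) => ->; rewrite orbF.
Qed.

Lemma trmx_mul_self_ge0 k (u : 'cV[R]_k) : 0 <= (u^T *m u) 0 0.
Proof.
by rewrite mxE; apply: sumr_ge0 => i _; rewrite mxE -expr2 sqr_ge0.
Qed.

Lemma trmx_mul_self_eq0 k (u : 'cV[R]_k) : u^T *m u = 0 -> u = 0.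
Proof.
move=> /matrixP/(_ 0 0); rewrite !mxE => /eqP.
rewrite psumr_eq0 => [/allP u0|i _]; last by rewrite mxE -expr2 sqr_ge0.
apply/matrixP => i j; rewrite ord1 mxE.
by have := u0 i (mem_index_enum _); rewrite mxE -expr2 sqrf_eq0 => /eqP.
Qed.

Lemma gossip_factor_kernel (v : 'cV[R]_(n + n)) :
  gossip_factor *m v = 0 <-> forall i j, v i 0 = v j 0.
Proof.
have ch : 0 < chi by exact: lt_le_trans ltr01 chi_ge1.
rewrite -(@vsubmxK _ n n _ v); set x := usubmx _; set y := dsubmx _.
have E : gossip_factor *m col_mx x y = col_mx (Num.sqrt 2^-1 *: (D *m (x + y)))
    (Num.sqrt chi *: (x - y)).
  rewrite /gossip_factor mul_block_col mulNmx !mul_scalar_mx -!scalemxAl mulmxDr.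
  by rewrite scalerDr scalerBr.
rewrite E; split=> [e|xc].
  move: (congr1 (@usubmx _ _ _ _) e) (congr1 (@dsubmx _ _ _ _) e).
  rewrite col_mxKu col_mxKd !linear0 => /eqP + /eqP.
  rewrite !scaler_eq0 !sqrtr_eq0 !leNgt ch invr_gt0 ltr0n /= => Dxy.
  rewrite subr_eq0 => /eqP xy; have Dx : forall i j, x i 0 = x j 0.
    apply/incidence_const/eqP; move: Dxy; rewrite -xy -mulr2n -scaler_nat.
    by rewrite -scalemxAr scaler_eq0 pnatr_eq0.
  move=> i j; rewrite -xy -(splitK i) -(splitK j).
  by case: (fintype.split i) => p; case: (fintype.split j) => q /=; rewrite ?col_mxEu ?col_mxEd.
have xy : x = y.
  apply/matrixP => p c; rewrite ord1; have := xc (lshift n p) (rshift n p).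
  by rewrite col_mxEu col_mxEd.
have Dx : D *m x = 0.
  apply/incidence_const => p q; have := xc (lshift n p) (lshift n q).
  by rewrite !col_mxEu.
by rewrite -xy subrr mulmxDr Dx addr0 !scaler0 col_mx0.
Qed.

Lemma gossip_kernel (v : 'cV[R]_(n + n)) : gossip *m v = 0 <-> forall i j, v i 0 = v j 0.
Proof.
rewrite -gossip_factor_kernel; split=> [Wv|rv]; last by rewrite -mulmxA rv mulmx0.
by apply: trmx_mul_self_eq0; rewrite trmx_mul -mulmxA (mulmxA _ gossip_factor) Wv mulmx0.
Qed.

Lemma gossip_is_gossip : gossip_matrix adjacent gossip.
Proof.
split; [split; first exact: gossip_sym | exact: gossip_neq0 | exact: gossip_kernel].
move=> v; have := trmx_mul_self_ge0 (gossip_factor *m v).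
by rewrite trmx_mul !mulmxA.
Qed.

(** Split an eigenvector into the sum and the difference of its two layers. *)
Lemma gossip_eigenvalue a : eigenvalue gossip a ->
  a = 2 * chi \/ exists2 z : 'cV[R]_n, z != 0 & L *m z = a *: z.
Proof.
move=> /(eigenvalue_col gossip_sym)[v v0]; move: v0.
rewrite -(@vsubmxK _ n n _ v); set x := usubmx _; set y := dsubmx _ => v0.
rewrite gossip_col scale_col_mx => e.
move: (congr1 (@usubmx _ _ _ _) e) (congr1 (@dsubmx _ _ _ _) e).
rewrite !col_mxKu !col_mxKd => ex ey.
have [xy|xy] := eqVneq x y; [right|left].
  exists (x + y).
    apply: contra_neq v0; rewrite -xy => /eqP.
    rewrite -mulr2n -scaler_nat scaler_eq0 pnatr_eq0 /= => /eqP ->.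
    exact: col_mx0.
  rewrite scalerDr -ex -ey addrACA subrr addr0 -scalerDl.
  by rewrite (_ : 2^-1 + 2^-1 = 1) ?scale1r //; field.
have : (2 * chi - a) *: (x - y) = 0.
  move: (2^-1 *: _) ex ey => A ex ey.
  rewrite scalerBl [X in _ - X]scalerBr -ex -ey.
  by apply/matrixP => i j; rewrite !mxE; ring.
move/eqP; rewrite scaler_eq0 !subr_eq0 (negbTE xy) orbF => /eqP //.
Qed.

Lemma gossip_condition_number :
  condition_number [set a | eigenvalue gossip a] chi.
Proof.
have ch : 0 < chi by exact: lt_le_trans ltr01 chi_ge1.
(* [2 * chi] comes from opposite layers, [2] from the linear profile on both. *)
exists (2 * chi), 2; split.
- split=> [|a /= /gossip_eigenvalue[->//|[z z0 Lz]]]; last first.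
    exact: path_eigenvalue_le z0 Lz degree_le.
  apply/(eigenvalue_col gossip_sym); exists (col_mx (const_mx 1) (- const_mx 1)).
    apply/eqP => /matrixP/(_ (lshift n (Ordinal (ltnW n_gt1))) 0)/eqP.
    by rewrite col_mxEu !mxE oner_eq0.
  rewrite gossip_col subrr mulmx0 scaler0 opprK add0r sub0r scale_col_mx.
  by rewrite scalerN -mulr2n -scaler_nat scalerA mulrC.
- split; last by [].
  apply/(eigenvalue_col gossip_sym).
  exists (col_mx (linear_profile n) (linear_profile n)).
    have := @linear_profile_neq0 R n n_gt1; apply: contra_neq => /eqP.
    by rewrite col_mx_eq0 andbb => /eqP.
  rewrite gossip_col subrr scaler0 subr0 addr0.
  have -> : linear_profile n + linear_profile n = 2 *: linear_profile n.
    by move=> r; rewrite scaler_nat mulr2n.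
  rewrite -scalemxAr scalerA mulVf ?pnatr_eq0 // scale1r.
  by rewrite path_laplacian_linear_profile scale_col_mx.
- move=> a /= /gossip_eigenvalue[->|[z z0 Lz]] a0; last first.
    exact: path_eigenvalue_ge z0 Lz a0.
  by rewrite ler_peMr.
- by field.
Qed.

End TwoLayers.

(** With [m] about [sqrt chi / 3], degrees are at most [(3 m) ^ 2 / 2 <= chi]. When
    [sqrt chi < 3] the choice [m = 1] works, since then all degrees are [1]. *)
Lemma chain_length (R : realType) (chi : R) : 1 <= chi ->
  exists m : nat, [/\ (0 < m)%N, Num.sqrt chi <= 6 * m%:R &
    forall p, (p < m * 3 - 1)%N -> degree (m * 3 - 1) p <= chi].
Proof.
move=> chi1; have chi0 : 0 <= chi by exact: le_trans ler01 chi1.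
have s0 : 0 <= Num.sqrt chi / 3 by rewrite divr_ge0 ?sqrtr_ge0.
have [k0|k0] := posnP (Num.truncn (Num.sqrt chi / 3)).
  exists 1%N; split => //.
    have := truncnS_gt (Num.sqrt chi / 3); rewrite k0 => h; lra.
  by move=> [|[|p]] // _; rewrite /degree /weight -natrD.
set k := Num.truncn _ in k0; exists k; split => //.
  have := truncnS_gt (Num.sqrt chi / 3); rewrite -/k.
  have : 1 <= k%:R :> R by rewrite ler1n.
  rewrite -[k.+1]addn1 natrD; lra.
move=> p pk.
have kchi : (k * 3)%:R ^+ 2 <= chi.
  rewrite -[leRHS]sqr_sqrtr // ler_sqr ?nnegrE ?ler0n ?sqrtr_ge0 //.
  by rewrite natrM -ler_pdivlMr // truncn_le.
apply: le_trans kchi; rewrite /degree /weight -natrD -natrX ler_nat.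
set N := (k * 3 - 1)%N in pk *.
have [q Nq] : exists q, N = (p + q.+1)%N by exists (N - p.+1)%N; lia.
have NK : (p + q.+2 <= k * 3)%N by move: Nq; rewrite /N; lia.
have -> : (N - p)%N = q.+1 by rewrite Nq addKn.
have -> : (N - p.+1)%N = q by rewrite Nq addnS -addSn addKn.
apply: (@leq_trans ((p + q.+2) ^ 2)%N); last by rewrite leq_exp2r.
by rewrite -mulnn; nia.
Qed.

(** * Travelling back and forth along a line *)

Section Zigzag.
Local Open Scope nat_scope.

Definition at_head (m p : nat) : bool := p < m.
Definition at_tail (m p : nat) : bool := m * 2 <= p.+1.

Definition flip_even (j : nat) := if odd j then j.-1 else j.+1.
Definition flip_odd (j : nat) := if odd j then j.+1 else j.-1.

Lemma flip_evenK : involutive flip_even.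
Proof.
move=> [|j] //; rewrite /flip_even /=.
by have [oj|oj] := boolP (odd j); rewrite /= ?oj ?(negbTE oj).
Qed.

Lemma flip_oddK : involutive flip_odd.
Proof.
move=> [|j] //; rewrite /flip_odd /=.
by have [oj|oj] := boolP (odd j); rewrite /= ?oj ?(negbTE oj).
Qed.

Lemma flip_even_le j : flip_even j <= j.+1.
Proof. by rewrite /flip_even; case: odd => //; lia. Qed.

Lemma flip_odd_le j : flip_odd j <= j.+1.
Proof. by rewrite /flip_odd; case: odd => //; lia. Qed.

(** A lower bound, up to the additive constant [m], for the number of steps along
    a line needed to make block [j] nonzero at position [p]. Information enters
    odd blocks at the head and even blocks at the tail; [t] is the position
    clamped to the stretch between them, so odd blocks are reached at increasing
    [t] and even ones at decreasing [t]. Both formulas agree where two consecutive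
    blocks are coupled, hence a coupling costs no steps, in either direction. *)
Definition zigzag (m j p : nat) : nat :=
  let t := minn (p.+1 - m) m in
  if odd j then j * m + t else j.+1 * m - t.

Lemma zigzag_ge m j p : j * m <= zigzag m j p.
Proof. by rewrite /zigzag mulSn; case: odd; lia. Qed.

Lemma zigzag0 m p : zigzag m 0 p <= m.
Proof. by rewrite /zigzag /=; lia. Qed.

Lemma zigzag_step m j p q : p <= q.+1 -> q <= p.+1 ->
  zigzag m j p <= (zigzag m j q).+1.
Proof. by rewrite /zigzag mulSn; case: odd; lia. Qed.

Lemma zigzag_flip_even m j p : at_head m p -> zigzag m (flip_even j) p = zigzag m j p.
Proof.
rewrite /at_head /zigzag /flip_even => pm; have -> : p.+1 - m = 0 by lia.
case: j => [|j] //=; first by rewrite min0n; lia.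
by have [oj|oj] := boolP (odd j); rewrite /= ?oj ?(negbTE oj) /= ?min0n; lia.
Qed.

Lemma zigzag_flip_odd m j p : at_tail m p -> zigzag m (flip_odd j) p = zigzag m j p.
Proof.
rewrite /at_tail /zigzag /flip_odd => pm; have -> : minn (p.+1 - m) m = m by lia.
case: j => [|j] //=.
by have [oj|oj] := boolP (odd j); rewrite /= ?oj ?(negbTE oj) /= ?mulSn; lia.
Qed.

End Zigzag.

(** * Hessians built from an involution *)

Section InvolutionHessian.
Context {R : realType} (s : nat -> nat) (sK : involutive s) (a b : R).
Implicit Types x y : l2 R.

Definition hessian x : l2 R := a *: x + b *: reindex sK x.

Lemma hessian_at x k : hessian x k = a * x k + b * x (s k).
Proof. by []. Qed.

Lemma hessian_linear : linear hessian.
Proof.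
move=> c x y; rewrite /hessian [reindex sK _]linearP !scalerDr !scalerA addrACA.
by rewrite (mulrC a) (mulrC b).
Qed.

HB.instance Definition _ := GRing.isLinear.Build R (l2 R) (l2 R) *:%R hessian
  hessian_linear.

Lemma dot_hessian x y : dot (hessian x) y = dot x (hessian y).
Proof. by rewrite /hessian !(dotDl, dotDr, dotZl, dotZr) dot_reindex. Qed.

Lemma dot_hessian_bounds x : b <= 0 ->
  (a + b) * `|x| ^+ 2 <= dot x (hessian x) <= (a - b) * `|x| ^+ 2.
Proof.
move=> b0; rewrite /hessian dotDr !dotZr -sqr_l2_norm.
have := dot_reindex_self_le sK x; rewrite ler_norml => /andP[h1 h2].
have := ler_wnM2l b0 h1; have := ler_wnM2l b0 h2.
by move=> h3 h4; apply/andP; split; lra.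
Qed.

End InvolutionHessian.

(** [P] being an involution, [(a + b P) (a - b P) = a ^ 2 - b ^ 2]. *)
Lemma hessian_cancel (R : realType) (s : nat -> nat) (sK : involutive s) (a b : R) :
  a ^+ 2 - b ^+ 2 != 0 ->
  cancel (hessian sK (a / (a ^+ 2 - b ^+ 2)) (- b / (a ^+ 2 - b ^+ 2)))
         (hessian sK a b).
Proof.
move=> ab x; apply: l2_ext => k.
by rewrite !hessian_at sK; field.
Qed.

Section HessianConjugate.
Context {R : realType} (s : nat -> nat) (sK : involutive s) (a b : R) (h : l2 R).
Implicit Types x v : l2 R.

Lemma dot_hessian_bounded (c d : R) x :
  `|dot x (hessian sK c d x)| <= (`|c| + `|d|) * `|x| ^+ 2.
Proof.
rewrite /hessian dotDr !dotZr mulrDl.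
apply: le_trans (ler_normD _ _) _; rewrite !normrM -sqr_l2_norm.
apply: lerD; first by rewrite normrX normr_id.
by rewrite ler_wpM2l // dot_reindex_self_le.
Qed.

Lemma gradient_hessian x v :
  gradient (quadratic (hessian sK a b) h 0) x v -> v = hessian sK a b x - h.
Proof.
apply: quadratic_gradientE; first exact: dot_hessian.
exact: dot_hessian_bounded.
Qed.

(** Only the form of the conjugate gradient matters for supports, not the
    coefficients. *)
Lemma gradient_fenchel_hessian x v : 0 < a - b -> 0 < a + b ->
  gradient (fenchel (quadratic (hessian sK a b) h 0)) x v ->
  exists c d, v = hessian sK c d (x + h).
Proof.
move=> ab ab'; have D : a ^+ 2 - b ^+ 2 != 0.
  by rewrite subr_sqr mulf_neq0 // gt_eqF.
have T0 y : 0 <= dot y (hessian sK a b y).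
  rewrite /hessian dotDr !dotZr -sqr_l2_norm.
  have := dot_reindex_self_le sK y; rewrite ler_norml => /andP[h1 h2]; nra.
rewrite (fenchel_quadratic _ _ (dot_hessian _ _ _) T0 (hessian_cancel sK D)).
set c := a / _; set d := _ / _.
move=> /(quadratic_gradientE (dot_hessian sK c d) (dot_hessian_bounded c d)) ->.
by exists c, d; rewrite opprK [RHS]linearD.
Qed.

End HessianConjugate.

(** * The hard problem and its solution *)

Section Counting.
Variable m : nat.
Hypothesis m_gt0 : (0 < m)%N.
Local Notation n := (m * 3 - 1)%N.

Lemma copies_gt0 : (0 < n + n)%N.
Proof. by move: m_gt0; lia. Qed.

Lemma chain_gt1 : (1 < n)%N.
Proof. by move: m_gt0; lia. Qed.

Lemma sum_ord_indicator (P : nat -> bool) a b : (a <= b)%N -> (b <= n)%N ->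
  (forall p, (p < n)%N -> P p = (a <= p < b)%N) ->
  (\sum_(p < n) P p = b - a)%N.
Proof.
move=> ab bn PE; rewrite (eq_bigr (fun p : 'I_n => nat_of_bool (a <= p < b)%N)).
  rewrite -(big_mkord xpredT (fun p => nat_of_bool (a <= p < b)%N)).
  rewrite (@big_cat_nat _ _ _ a) ?(leq_trans ab) //=.
  rewrite (@big_cat_nat _ _ _ b a n) //=.
  rewrite big_nat big1 ?add0n => [|i /andP[_ ia]]; last by rewrite leqNgt ia.
  rewrite [X in (_ + X)%N]big_nat [X in (_ + X)%N]big1 ?addn0 => [|i /andP[ib _]].
    rewrite big_nat (eq_bigr (fun=> 1%N)) => [|i -> //].
    by rewrite -big_nat sum_nat_const_nat muln1.
  by rewrite (ltnNge i) ib andbF.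
by move=> p _; rewrite PE.
Qed.

Lemma sum_position (P : nat -> bool) :
  (\sum_(i < n + n) P (position i) = (\sum_(p < n) P p) * 2)%N.
Proof.
rewrite big_split_ord /= muln2 -addnn; congr (_ + _)%N.
  by apply: eq_bigr => p _; rewrite position_lshift.
by apply: eq_bigr => p _; rewrite position_rshift.
Qed.

Lemma sum_at_head : (\sum_(i < n + n) at_head m (position i) = m * 2)%N.
Proof.
rewrite sum_position (@sum_ord_indicator _ 0 m) ?subn0 //; lia.
Qed.

Lemma sum_at_tail : (\sum_(i < n + n) at_tail m (position i) = m * 2)%N.
Proof.
rewrite sum_position (@sum_ord_indicator _ (m * 2 - 1) n) //; try lia.
by move=> p pn; rewrite /at_tail pn andbT; lia.
Qed.

Lemma at_head_not_tail p : at_head m p -> at_tail m p = false.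
Proof. by rewrite /at_head /at_tail => pm; apply/negbTE; lia. Qed.

End Counting.

Section HardProblem.
Context {R : realType} (LF mu chiA q : R) (m m' : nat).
Hypotheses (mu_gt0 : 0 < mu) (mu_le : mu <= LF) (chiA_ge1 : 1 <= chiA).
Hypotheses (m_gt0 : (0 < m)%N) (m'_gt0 : (0 < m')%N).
Local Notation n := (m * 3 - 1)%N.
Local Notation n' := (m' * 3 - 1)%N.
Local Notation B := (n' + n')%N.

Local Notation offset := (offset (copies_gt0 m'_gt0)).
Local Notation blockop := (blockop (copies_gt0 m'_gt0)).

Definition shift_block (flip : nat -> nat) (k : nat) : nat :=
  (flip (k %/ B) * B + k %% B)%N.

Lemma shift_block_div flip k : (shift_block flip k %/ B = flip (k %/ B))%N.
Proof. exact: (block_of (copies_gt0 m'_gt0) _ (offset k)). Qed.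

Lemma offset_shift_block flip k : offset (shift_block flip k) = offset k.
Proof. exact: (offset_of (copies_gt0 m'_gt0) _ (offset k)). Qed.

Lemma shift_blockK flip : involutive flip -> involutive (shift_block flip).
Proof.
move=> fK k; rewrite {1}/shift_block shift_block_div fK.
have /(congr1 val)/= -> := offset_shift_block flip k.
by rewrite -divn_eq.
Qed.

(** The coordinate coupled with [k] in the objective of agent [i]. A coupling
    keeps the offset within the block, so it needs both the agent and the copy
    at the same end of their lines. *)
Definition partner (i : 'I_(n + n)) (k : nat) : nat :=
  if at_head m (position i) && at_head m' (position (offset k))
  then shift_block flip_even k
  else if at_tail m (position i) && at_tail m' (position (offset k))
  then shift_block flip_odd k
  else k.

Lemma partnerK i : involutive (partner i).
Proof.
move=> k; rewrite {2}/partner.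
case: ifP => [c|/negbT c].
  by rewrite /partner offset_shift_block c shift_blockK //; exact: flip_evenK.
case: ifP => [c'|/negbT c'].
  rewrite /partner offset_shift_block (negbTE c) c' shift_blockK //.
  exact: flip_oddK.
by rewrite /partner (negbTE c) (negbTE c').
Qed.

(** The coupling strength for which the Hessians have spectrum between [mu] and
    [LF]. *)
Definition beta : R := (LF - mu) / 2.

Lemma beta_ge0 : 0 <= beta.
Proof. by rewrite divr_ge0 // subr_ge0. Qed.

(** The linear term for which [q ^ j] is also stationary in block [0], where one of
    the two neighbours is missing. *)
Definition pull : R := mu + (4 * m * m')%:R * beta * (1 - q) / ((n + n) * B)%:R.

Definition source : l2 R := embed (copies_gt0 m'_gt0) (const_mx pull).

Definition agent_hessian i := hessian (partnerK i) (mu + beta) (- beta).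

Definition hard_problem : problem R :=
  @Problem R (n + n)
    (@adjacent n)
    (fun i => quadratic (agent_hessian i) source 0)
    (fun=> blockop (gossip_factor n' chiA))
    (fun=> blockop (gossip_factor n' chiA)^T)
    (fun=> 0)
    (fun=> 0).

Lemma agent_hessian_bounds i x :
  mu * `|x| ^+ 2 <= dot x (agent_hessian i x) <= LF * `|x| ^+ 2.
Proof.
have := dot_hessian_bounds (partnerK i) (mu + beta) x (_ : - beta <= 0).
rewrite oppr_le0 => /(_ beta_ge0); rewrite addrK opprK.
by rewrite (_ : mu + beta + beta = LF) // /beta; field.
Qed.

Lemma agent_hessian_sym i x y :
  dot (agent_hessian i x) y = dot x (agent_hessian i y).
Proof. exact: dot_hessian. Qed.

Lemma agent_hessian_ge0 i x : 0 <= dot x (agent_hessian i x).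
Proof.
have /andP[+ _] := agent_hessian_bounds i x; apply: le_trans.
by rewrite mulr_ge0 ?exprn_ge0 // ltW.
Qed.

Lemma agent_hessian_bounded i x : `|dot x (agent_hessian i x)| <= LF * `|x| ^+ 2.
Proof.
by rewrite ger0_norm ?agent_hessian_ge0 //; have /andP[] := agent_hessian_bounds i x.
Qed.

Lemma hard_problem_well_posed : well_posed hard_problem LF mu.
Proof.
split.
- move=> i; split.
    apply: (quadratic_smooth _ _ (agent_hessian_sym i) (agent_hessian_bounded i)).
    by move=> x; have /andP[] := agent_hessian_bounds i x.
  apply: (quadratic_strongly_convex _ _ (agent_hessian_sym i) (agent_hessian_bounded i)).
  by move=> x; have /andP[] := agent_hessian_bounds i x.
- move=> i; split; first exact: blockop_continuous.
  by move=> x y; exact: dot_blockop.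
- by split; [exact: adjacent_sym | exact: adjacent_irreflexive].
Qed.

Lemma hard_problem_gram_condition_number :
  (forall p, (p < n')%N -> degree n' p <= chiA) ->
  gram_condition_number hard_problem chiA.
Proof.
move=> dA; have n'1 := chain_gt1 m'_gt0.
have E : gram (P := hard_problem) =
    diag_blockop (copies_gt0 m'_gt0) (I := 'I_(n + n)) (gossip n' chiA).
  apply/funext => x; apply/ffunP => i; rewrite !ffunE /=.
  by rewrite blockop_mul.
have n0 := copies_gt0 m_gt0.
have S := gossip_sym n' chiA.
have C := gossip_condition_number n'1 chiA_ge1 dA.
rewrite /gram_condition_number E.
split; first by rewrite (point_spectrum_diag_blockop _ (Ordinal n0) S).
by rewrite (spectrum_diag_blockop _ (Ordinal n0) S).
Qed.

Hypotheses (q_ge0 : 0 <= q) (q_lt1 : q < 1).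

Lemma solution_summable : (fun k => q ^+ (k %/ B)%N) \in square_summable.
Proof.
apply: (@square_summable_bounded _ _ (B%:R / (1 - q))) => K.
exists (K * B)%N; first by rewrite leq_pmulr // (copies_gt0 m'_gt0).
rewrite big_blocks.
under eq_bigr => j _ do under eq_bigr => c _ do rewrite (block_of (copies_gt0 m'_gt0)).
under eq_bigr => j _ do rewrite sumr_const card_ord -mulr_natl.
rewrite -mulr_sumr ler_wpM2l //.
apply: (@le_trans _ _ (\sum_(j < K) q ^+ j)).
  apply: ler_sum => j _; rewrite expr2 ler_piMr ?exprn_ge0 //.
  by rewrite exprn_ile1 // ltW.
rewrite -[leRHS]div1r ler_pdivlMr ?subr_gt0 // mulrC -[1 - q]opprB mulNr.
by rewrite -subrX1 opprB gerBl exprn_ge0.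
Qed.

Definition solution : l2 R := L2 solution_summable.

Lemma block_solution j : block B solution j = const_mx (q ^+ j).
Proof. by apply/matrixP => c d; rewrite !mxE /= (block_of (copies_gt0 m'_gt0)). Qed.

Lemma residual_at i j (c : 'I_B) :
  (agent_hessian i solution - source) (j * B + c)%N =
  mu * q ^+ j - pull * (j == 0)%:R
  + beta * (q ^+ j - q ^+ flip_even j)
    * ((at_head m (position i))%:R * (at_head m' (position c))%:R)
  + beta * (q ^+ j - q ^+ flip_odd j)
    * ((at_tail m (position i))%:R * (at_tail m' (position c))%:R).
Proof.
rewrite l2_add l2_opp hessian_at.
have -> : source (j * B + c)%N = pull * (j == 0)%:R.
  rewrite /= offset_of mxE; case: j => [|j].
    by rewrite mul0n ltn_ord mulr1.
  by rewrite mulSn -addnA ltnNge leq_addr mulr0.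
rewrite /= (block_of (copies_gt0 m'_gt0)) /partner offset_of.
case: (boolP (at_head m (position i))) => hi /=.
  rewrite (at_head_not_tail m_gt0 hi) /=.
  case: (boolP (at_head m' (position c))) => hc /=.
    by rewrite shift_block_div (block_of (copies_gt0 m'_gt0)); ring.
  by rewrite (block_of (copies_gt0 m'_gt0)); ring.
case: (boolP (at_tail m (position i))) => ti /=.
  case: (boolP (at_tail m' (position c))) => tc /=.
    by rewrite shift_block_div (block_of (copies_gt0 m'_gt0)); ring.
  by rewrite (block_of (copies_gt0 m'_gt0)); ring.
by rewrite (block_of (copies_gt0 m'_gt0)); ring.
Qed.

Hypothesis qE : ((n + n) * B)%:R * mu * q = (4 * m * m')%:R * beta * (1 - q) ^+ 2.

(** Stationarity only has to hold along the constraint set, where the entries of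
    a direction within a block agree. It is therefore enough that the gradient
    sums to zero over each block: for [j > 0] this is
    [Y mu q ^ j = X beta (q ^ (j-1) - 2 q ^ j + q ^ (j+1))], with [X = 4 m m'] and
    [Y] the number of agents times the block length. *)
Lemma residual_block_sum j :
  \sum_(c < B) \sum_i (agent_hessian i solution - source) (j * B + c)%N = 0.
Proof.
rewrite exchange_big.
under eq_bigr => i _ do under eq_bigr => c _ do rewrite residual_at.
under eq_bigr => i _ do rewrite !big_split /= -!mulr_sumr.
rewrite !big_split /= -!mulr_sumr -!mulr_suml.
rewrite -!natr_sum !sum_at_head // !sum_at_tail // -!natrM.
rewrite !sumr_const !card_ord -!mulrnA (mulnC B).
rewrite -(mulr_natr (q ^+ j)) -(mulr_natr (- _)).
have NB : ((n + n) * B)%:R != 0 :> R.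
  by rewrite pnatr_eq0 muln_eq0; move: m_gt0 m'_gt0; lia.
have -> : (m * 2 * (m' * 2))%N = (4 * m * m')%N by lia.
move: qE NB; rewrite /pull; set X := (4 * m * m')%:R; set Y := ((n + n) * B)%:R.
clearbody X Y.
move=> e Y0; case: j => [|j]; rewrite /flip_even /flip_odd /=.
  field; exact: Y0.
have E : Y * mu * q - X * beta * (1 - q) ^+ 2 = 0 by rewrite e subrr.
by case: (odd j) => /=; rewrite -[RHS](mul0r (q ^+ j)) -E !exprS; ring.
Qed.

Lemma solution_feasible : feasible (P := hard_problem) (fun=> solution).
Proof.
split => // i; apply: (block_inj (copies_gt0 m'_gt0)) => j.
rewrite block_blockop block_solution.
have n'1 := chain_gt1 m'_gt0.
have -> : block B (0 : l2 R) j = 0 by apply/matrixP => c d; rewrite !mxE.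
by apply/gossip_factor_kernel => // c d; rewrite !mxE.
Qed.

Lemma dot_sum (I : finType) (F : I -> l2 R) y :
  \sum_i dot (F i) y = dot (\sum_i F i) y.
Proof.
by elim/big_rec2: _ => [|i x z _ ->]; rewrite ?dot0l ?dotDl.
Qed.

(** The first-order term vanishes along feasible directions, and the remaining
    second-order term is nonnegative. *)
Lemma solution_is_solution : is_solution (P := hard_problem) (fun=> solution).
Proof.
split=> [|y [yf yc]]; first exact: solution_feasible.
have N0 := copies_gt0 m_gt0.
pose d := y (Ordinal N0) - solution.
have yE i : y i = solution + d by rewrite (yc i (Ordinal N0)) addrC subrK.
have dj j : forall c e, block B d j c 0 = block B d j e 0.
  apply/(gossip_factor_kernel chiA_ge1); rewrite -(block_blockop (copies_gt0 m'_gt0)).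
  rewrite /d linearB /= (yf (Ordinal N0)) (solution_feasible.1 (Ordinal N0)) subrr.
  by apply/matrixP => c e; rewrite !mxE.
have first_order : dot (\sum_i (agent_hessian i solution - source)) d = 0.
  rewrite -(dot0l (0 : l2 R)); apply: (dot_blocks_eq (copies_gt0 m'_gt0)) => j.
  have -> : block B (0 : l2 R) j = 0 by apply/matrixP => c e; rewrite !mxE.
  rewrite trmx0 mul0mx; apply/matrixP => a b; rewrite !ord1 !mxE.
  rewrite (eq_bigr (fun c : 'I_B => (\sum_i (agent_hessian i solution - source)
    (j * B + c)%N) * block B d j (offset 0) 0)).
    by rewrite -mulr_suml residual_block_sum mul0r.
  by move=> c _; rewrite (dj j c (offset 0)) !mxE l2_sum.
rewrite -subr_ge0 -sumrB.
rewrite (eq_bigr (fun i => dot (agent_hessian i solution - source) d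
    + dot d (agent_hessian i d) / 2)).
  rewrite big_split /= dot_sum first_order add0r; apply: sumr_ge0 => i _.
  by rewrite divr_ge0 // agent_hessian_ge0.
move=> i _ /=; rewrite yE (quadratic_expand _ _ (agent_hessian_sym i) solution).
by rewrite [solution + d]addrC addrK; ring.
Qed.

End HardProblem.

(** * Supports of the memories *)

Section Reachability.
Context {R : realType} (LF mu chiA q : R) (m m' : nat).
Hypotheses (mu_gt0 : 0 < mu) (mu_le : mu <= LF).
Hypotheses (m_gt0 : (0 < m)%N) (m'_gt0 : (0 < m')%N).
Local Notation n := (m * 3 - 1)%N.
Local Notation n' := (m' * 3 - 1)%N.
Local Notation B := (n' + n')%N.
Local Notation offset := (offset (copies_gt0 m'_gt0)).
Local Notation P := (hard_problem LF mu chiA q m m'_gt0).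
Local Notation source := (source LF mu q m m'_gt0).

(** Coordinate [k] may be nonzero in the memory of agent [i] after [l] local
    computations, [s] communications and [t] multiplications. *)
Definition reachable (l s t : nat) (i : 'I_(n + n)) (k : nat) : bool :=
  [&& k %/ B <= l, zigzag m (k %/ B) (position i) <= s + m
    & zigzag m' (k %/ B) (position (offset k)) <= t + m']%N.

Lemma reachable_mono l s t l' s' t' i k :
  (l <= l')%N -> (s <= s')%N -> (t <= t')%N ->
  reachable l s t i k -> reachable l' s' t' i k.
Proof.
move=> ll ss tt /and3P[h1 h2 h3]; apply/and3P; split.
- exact: leq_trans ll.
- by rewrite (leq_trans h2) // leq_add2r.
- by rewrite (leq_trans h3) // leq_add2r.
Qed.

(** A coupling used by agent [i] joins the two blocks at an end of both lines,
    where neither [zigzag] changes. *)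
Lemma reachable_partner l s t i k :
  reachable l s t i (partner m'_gt0 i k) -> reachable l.+1 s t i k.
Proof.
rewrite /partner; case: ifP => [/andP[hi hk]|_].
  rewrite /reachable (shift_block_div m'_gt0) offset_shift_block.
  rewrite !zigzag_flip_even // => /and3P[h -> ->]; rewrite !andbT.
  by rewrite -[(k %/ B)%N]flip_evenK (leq_trans (flip_even_le _)).
case: ifP => [/andP[hi hk]|_].
  rewrite /reachable (shift_block_div m'_gt0) offset_shift_block.
  rewrite !zigzag_flip_odd // => /and3P[h -> ->]; rewrite !andbT.
  by rewrite -[(k %/ B)%N]flip_oddK (leq_trans (flip_odd_le _)).
exact: reachable_mono.
Qed.

Lemma reachable_source l s t i k : source k != 0 -> reachable l s t i k.
Proof.
rewrite /=; case: ifP => [kB _|]; last by rewrite eqxx.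
rewrite /reachable divn_small //=.
by rewrite !(leq_trans (zigzag0 _ _)) ?leq_addl.
Qed.

Definition supported (S : pred nat) (x : l2 R) := forall k, x k != 0 -> S k.

Lemma supported0 S : supported S 0.
Proof. by move=> k; rewrite l2_zero eqxx. Qed.

Lemma supportedD S x y : supported S x -> supported S y -> supported S (x + y).
Proof.
move=> xS yS k; rewrite l2_add; have [->|/xS//] := eqVneq (x k) 0.
by rewrite add0r => /yS.
Qed.

Lemma supportedZ S a x : supported S x -> supported S (a *: x).
Proof. by move=> xS k; rewrite l2_scale mulf_eq0 negb_or => /andP[_ /xS]. Qed.

Lemma supportedN S x : supported S x -> supported S (- x).
Proof. by rewrite -scaleN1r; exact: supportedZ. Qed.

Lemma supported_span S (G : set (l2 R)) :
  G `<=` supported S -> Defs.span G `<=` supported S.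
Proof.
move=> GS _ [p [c [u [uG ->]]]]; elim/big_ind: _ => [|x y|k _].
- exact: supported0.
- exact: supportedD.
- by apply: supportedZ; apply: GS.
Qed.

Lemma supported_sub (S S' : pred nat) x :
  (forall k, S k -> S' k) -> supported S x -> supported S' x.
Proof. by move=> SS xS k /xS/SS. Qed.

Lemma supported_hessian l s t i a b x :
  supported (reachable l s t i) x ->
  supported (reachable l.+1 s t i) (hessian (partnerK m'_gt0 i) a b x).
Proof.
move=> xS; apply: supportedD; apply: supportedZ => k.
  by move=> /xS; exact: reachable_mono.
by move=> /xS /reachable_partner.
Qed.

Lemma supported_local l s t i x v :
  supported (reachable l s t i) x ->
  [\/ v = x, gradient (@fobj _ P i) x v | gradient (fenchel (@fobj _ P i)) x v] ->
  supported (reachable l.+1 s t i) v.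
Proof.
move=> xS.
have b0 : 0 <= beta LF mu by exact: beta_ge0.
have hS l' : supported (reachable l' s t i) source.
  by move=> k; exact: reachable_source.
case=> [->|/gradient_hessian ->|/gradient_fenchel_hessian].
- by apply: supported_sub xS => k; exact: reachable_mono.
- by apply: supportedD; [exact: supported_hessian | exact: supportedN].
- case=> [||a [b ->]]; try by move: (beta LF mu) b0 mu_gt0 => ?; lra.
  by apply: supported_hessian; exact: supportedD.
Qed.

Lemma reachable_neighbor l s t i j k : adjacent i j ->
  reachable l s t j k -> reachable l s.+1 t i k.
Proof.
move=> /and3P[_ ij ji] /and3P[h1 h2 h3]; apply/and3P; split => //.
by rewrite (leq_trans (zigzag_step _ _ ij ji)).
Qed.

Hypotheses (chiA_ge1 : 1 <= chiA)
  (degree_le : forall p, (p < n')%N -> degree n' p <= chiA).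

Lemma supported_gram l s t i x :
  supported (reachable l s t i) x ->
  supported (reachable l s t.+1 i)
    (blockop (copies_gt0 m'_gt0) (gossip n' chiA) x).
Proof.
move=> xS k; rewrite /= /blockseq mxE => sum0.
have n'1 := chain_gt1 m'_gt0.
have [c /andP[Wc xc]] : exists c, (gossip n' chiA (offset k) c != 0)
    && (x ((k %/ B) * B + c)%N != 0).
  apply/existsP; apply: contraNT sum0 => /existsPn z; apply/eqP.
  apply: big1 => c _; have := z c; rewrite negb_and !negbK [block _ _ _ _ _]mxE.
  by case/orP => /eqP ->; rewrite ?mul0r ?mulr0.
have /and3P[h1 h2 h3] := xS _ xc.
rewrite (block_of (copies_gt0 m'_gt0)) in h1 h2 h3; rewrite offset_of in h3.
apply/and3P; split => //; apply: leq_trans (zigzag_step _ _ _ _) _; last first.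
- by rewrite addSn ltnS; exact: h3.
- move: Wc; rewrite gossip_neq0 // => /orP[/and3P[_ _ //]|/eqP ->]; exact: leqnSn.
- move: Wc; rewrite gossip_neq0 // => /orP[/and3P[_ //]|/eqP ->]; exact: leqnSn.
Qed.

Definition actions (act : nat -> action) (a : action) (k : nat) : nat :=
  count_mem a (mkseq act k).

Lemma actionsS act a k : actions act a k.+1 = (actions act a k + (act k == a))%N.
Proof. by rewrite /actions mkseqS -cats1 count_cat /= addn0. Qed.

(** Local computations move support along [partner], communications between
    neighbouring agents, multiplications between neighbouring copies of a block. *)
Lemma supported_memory act keep k i :
  memory (P := P) act keep k i `<=`
  supported (reachable (actions act LocalComputation k)
    (actions act Communication k) (actions act Multiplication k) i).
Proof.
elim: k i => [|k IH] i; first by move=> _ ->; exact: supported0.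
rewrite /=; apply: supported_span => v; rewrite !actionsS.
have stay x : memory (P := P) act keep k i x ->
    supported (reachable (actions act LocalComputation k + (act k == LocalComputation))
      (actions act Communication k + (act k == Communication))
      (actions act Multiplication k + (act k == Multiplication)) i) x.
  by move=> /IH; apply: supported_sub => h; apply: reachable_mono; exact: leq_addr.
case=> [|]; last first.
  case: (keep k) => // -[/stay//|[_ ->]].
  rewrite /= linear0; exact: supported0.
case: (act k) stay => /= stay; rewrite !(addn0, addn1) in stay *.
- by move=> [x /IH xS]; exact: supported_local.
- move=> [j ij /IH]; apply: supported_sub => h; exact: reachable_neighbor.
- move=> [->|[x /IH xS ->]]; first exact: supported0.
  by rewrite blockop_mul; exact: supported_gram.
Qed.

End Reachability.

(** * Decay of the solution and the lower bounds *)

Section Rate.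
Context {R : realType} (LF mu q : R) (m m' : nat).
Hypotheses (mu_gt0 : 0 < mu) (mu_le : mu <= LF).
Hypotheses (m_gt0 : (0 < m)%N) (m'_gt0 : (0 < m')%N).
Local Notation n := (m * 3 - 1)%N.
Local Notation n' := (m' * 3 - 1)%N.
Local Notation B := (n' + n')%N.

(** The two sides compare in opposite ways at [r = 0] and at [r = 1]. *)
Lemma ratio_exists : exists r : R, [/\ 0 <= r, r < 1 &
  ((n + n) * B)%:R * mu * r = (4 * m * m')%:R * beta LF mu * (1 - r) ^+ 2].
Proof.
set Y : R := ((n + n) * B)%:R; set X : R := (4 * m * m')%:R.
have Y0 : 0 < Y by rewrite ltr0n muln_gt0 !copies_gt0.
have X0 : 0 <= X by exact: ler0n.
have b0 := beta_ge0 mu_le.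
pose p : {poly R} := (Y * mu) *: 'X - (X * beta LF mu) *: (1 - 'X) ^+ 2.
have pE r : p.[r] = Y * mu * r - X * beta LF mu * (1 - r) ^+ 2.
  by rewrite /p !hornerE.
have Ymu : 0 < Y * mu by rewrite mulr_gt0.
have [||r /andP[r0 r1] /rootP pr] := @poly_ivt R p 0 1; first exact: ler01.
  rewrite !pE mulr0 subr0 expr1n mulr1 sub0r oppr_le0 mulr_ge0 //=.
  by rewrite subrr expr0n mulr0 subr0 mulr1 ltW.
move: pr; rewrite pE => /eqP; rewrite subr_eq0 => /eqP e.
exists r; split => //; rewrite lt_neqAle r1 andbT; apply/eqP => r1E.
move: e; rewrite r1E subrr expr0n mulr0 mulr1 => /eqP.
by rewrite gt_eqF.
Qed.

Hypotheses (q_ge0 : 0 <= q) (q_lt1 : q < 1).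
Hypothesis qE : ((n + n) * B)%:R * mu * q = (4 * m * m')%:R * beta LF mu * (1 - q) ^+ 2.
Hypothesis kappa_ge : 144 <= LF / mu.

Lemma sqrt_kappa_ge : 12 <= Num.sqrt (LF / mu).
Proof.
rewrite -[12]ger0_norm // -sqrtr_sqr ler_wsqrtr //.
by apply: le_trans kappa_ge; rewrite -natrX ler_nat.
Qed.

(** As [n <= 3 m] on both lines, [(1 - q) ^ 2 <= 9 mu q / beta], and
    [beta = (LF - mu) / 2]. *)
Lemma gap_le : (1 - q) * Num.sqrt (LF / mu) <= 6.
Proof.
have k0 : 0 <= LF / mu by apply: le_trans kappa_ge.
rewrite -ler_sqr ?nnegrE ?mulr_ge0 ?sqrtr_ge0 ?subr_ge0 ?ltW //.
rewrite exprMn sqr_sqrtr //.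
have YX : ((n + n) * B)%:R <= 9 * (4 * m * m')%:R :> R.
  by rewrite -natrM ler_nat; move: m_gt0 m'_gt0; nia.
have X0 : 0 < (4 * m * m')%:R :> R by rewrite ltr0n !muln_gt0 m_gt0.
have muq : 0 <= mu * q by rewrite mulr_ge0 // ltW.
have bE : beta LF mu = mu * (LF / mu - 1) / 2.
  by rewrite /beta; field; rewrite gt_eqF.
have kappa := kappa_ge; move: qE; rewrite bE; set k := LF / mu in k0 kappa *.
move: (_%:R) YX => Y YX.
move: (_%:R) X0 YX => X X0 YX e.
have h1 : X * (mu * (k - 1) / 2) * (1 - q) ^+ 2 <= X * (9 * (mu * q)).
  by rewrite -e; have := ler_wpM2r muq YX; lra.
have h2 : (k - 1) * (1 - q) ^+ 2 <= 18 * q.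
  by rewrite -(ler_pM2l mu_gt0) -(ler_pM2l X0); lra.
have h3 : k <= 2 * (k - 1) by lra.
have := ler_wpM2r (sqr_ge0 (1 - q)) h3; have := q_lt1; lra.
Qed.

(** Here [ln (1 / q) <= (1 - q) / q <= 2 (1 - q) <= 12 / sqrt (LF / mu)]. *)
Lemma decay_bound J eps : 0 < eps -> (q ^+ J) ^+ 2 <= eps ->
  Num.sqrt (LF / mu) * ln (1 / eps) <= 24 * J%:R.
Proof.
move=> e0 qJ; have sk := sqrt_kappa_ge; have gap := gap_le.
set K := Num.sqrt _ in sk gap *.
have K0 : 0 < K by lra.
have q2 : 2^-1 <= q.
  rewrite leNgt; apply/negP => q2.
  by have : 2^-1 * K < (1 - q) * K by [rewrite ltr_pM2r //; lra]; lra.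
have q0 : 0 < q by lra.
have lnq : ln (1 / q) <= 2 * (1 - q).
  have -> : 1 / q = 1 + (1 - q) / q by field; rewrite gt_eqF.
  have d0 : 0 <= (1 - q) / q by rewrite divr_ge0 // subr_ge0 ltW.
  apply: le_trans (le_ln1Dx _) _; first by lra.
  have g0 : 0 <= 1 - q by rewrite subr_ge0 ltW.
  by rewrite ler_pdivrMr //; have := ler_wpM2l g0 q2; lra.
have lneps : ln (1 / eps) <= ln (1 / q) * (J * 2)%:R.
  have -> : ln (1 / q) * (J * 2)%:R = ln ((1 / q) ^+ (J * 2)).
    by rewrite lnXn ?mulr_natr // divr_gt0.
  rewrite ler_ln ?posrE ?exprn_gt0 ?divr_gt0 // expr_div_n expr1n !div1r.
  by rewrite lef_pV2 ?posrE ?exprn_gt0 // exprM.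
apply: le_trans (ler_wpM2l (ltW K0) lneps) _.
apply: le_trans (ler_wpM2l (ltW K0) (ler_wpM2r (ler0n _ _) lnq)) _.
rewrite natrM; have J0 : 0 <= J%:R :> R by exact: ler0n.
have -> : K * (2 * (1 - q) * (J%:R * 2)) = ((1 - q) * K) * J%:R * 4 by ring.
have := ler_wpM2r J0 gap; lra.
Qed.

End Rate.

Section LowerBound.
Context {R : realType} (LF mu chiA q : R) (m m' : nat).
Hypotheses (mu_gt0 : 0 < mu) (mu_le : mu <= LF).
Hypotheses (m_gt0 : (0 < m)%N) (m'_gt0 : (0 < m')%N) (chiA_ge1 : 1 <= chiA).
Local Notation n := (m * 3 - 1)%N.
Local Notation n' := (m' * 3 - 1)%N.
Local Notation B := (n' + n')%N.
Local Notation P := (hard_problem LF mu chiA q m m'_gt0).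
Hypotheses (degree_le : forall p, (p < n')%N -> degree n' p <= chiA).
Hypotheses (q_ge0 : 0 <= q) (q_lt1 : q < 1).
Local Notation xs := (solution m'_gt0 q_ge0 q_lt1).

(** The first entry of an unreached block [J] is zero in the output, but [q ^ J] in
    the solution. *)
Lemma unreachable_error (alg : algorithm P) k eps J :
  accurate alg xs eps k ->
  [|| action_count alg LocalComputation k < J,
      action_count alg Communication k + m < J * m
    | action_count alg Multiplication k + m' < J * m']%N ->
  (q ^+ J) ^+ 2 <= eps.
Proof.
move=> acc far; have i0 : 'I_(n + n) := Ordinal (copies_gt0 m_gt0).
have c0 : 'I_B := Ordinal (copies_gt0 m'_gt0).
have z : output alg k i0 (J * B + c0)%N = 0.
  have := supported_memory mu_gt0 mu_le chiA_ge1 degree_le (@outputP _ _ alg k i0).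
  move=> /(_ (J * B + c0)%N)/contraNeq; apply; apply: contraL far.
  rewrite /reachable (block_of (copies_gt0 m'_gt0)) => /and3P[h1 h2 h3].
  rewrite !negb_or -!leqNgt h1 /=; apply/andP; split.
    exact: leq_trans (zigzag_ge _ _ _) h2.
  exact: leq_trans (zigzag_ge _ _ _) h3.
apply: le_trans (acc i0); rewrite sqr_l2_norm.
apply: le_trans (sqr_le_dot _ (J * B + c0)%N).
by rewrite l2_add l2_opp z sub0r sqrrN /= (block_of (copies_gt0 m'_gt0)).
Qed.

End LowerBound.

Theorem theorem1 (R : realType) :
  exists c C kappa0 : R, (0 < c /\ 0 < C) /\
  forall LF muF chiW chiA : R,
    0 < muF -> muF <= LF -> 1 <= chiW -> 1 <= chiA ->
  exists (P : problem R) (W : 'M[R]_(agents P)) (xs : l2 R),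
    [/\ well_posed P LF muF,
        gossip_matrix (@edge R P) W,
        condition_number [set a | eigenvalue W a] chiW,
        gram_condition_number P chiA
      & is_solution (fun _ : 'I_(agents P) => xs)] /\
    (kappa0 <= LF / muF ->
     exists eps0 : R, 0 < eps0 /\
     forall eps : R, 0 < eps -> eps < eps0 ->
     exists N Ncomm Nmult : R,
       [/\ theta_bounds c C (Num.sqrt (LF / muF) * ln (1 / eps)) N,
           theta_bounds c C (N * Num.sqrt chiW) Ncomm
         & theta_bounds c C (N * Num.sqrt chiA) Nmult] /\
       forall (alg : algorithm P) (k : nat), accurate alg xs eps k ->
         [/\ N <= (action_count alg LocalComputation k)%:R,
             Ncomm <= (action_count alg Communication k)%:R
           & Nmult <= (action_count alg Multiplication k)%:R]).
Proof.
(* [T / 24] blocks are needed; the additive constants, at most two blocks, are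
   absorbed by halving, as [T >= 12 * 8]. The distance [m >= sqrt chi / 6] costs
   the remaining factor [6]. *)
exists 48^-1, 1, 144; split; first by split.
move=> LF mu chiW chiA mu0 muLF chiW1 chiA1.
have [m [m0 mW dW]] := chain_length chiW1.
have [m' [m'0 mA dA]] := chain_length chiA1.
have [q [q0 q1 qE]] := ratio_exists mu0 muLF m0 m'0.
have n1 := chain_gt1 m0.
exists (hard_problem LF mu chiA q m m'0), (gossip (m * 3 - 1) chiW),
  (solution m'0 q0 q1); split.
  split; first exact: hard_problem_well_posed.
  - exact: gossip_is_gossip.
  - exact: gossip_condition_number.
  - exact: hard_problem_gram_condition_number.
  - exact: solution_is_solution.
move=> kappa; exists (expR (- 8)); split; first exact: expR_gt0.
move=> eps e0 e8; set T := Num.sqrt (LF / mu) * ln (1 / eps).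
have T96 : 96 <= T.
  have -> : 96 = 12 * 8 :> R by rewrite -natrM.
  apply: ler_pM => //; first exact: sqrt_kappa_ge.
  rewrite div1r lnV ?posrE // lerNr -[leRHS]expRK.
  by rewrite ler_ln ?posrE ?expR_gt0 // ltW.
have theta (x y : R) : 0 <= x -> 6^-1 * x = y \/ 48^-1 * x = y ->
    theta_bounds 48^-1 1 x y.
  by move=> x0 [<-|<-]; apply/andP; split; lra.
have N0 : 0 <= 48^-1 * T by rewrite mulr_ge0 ?invr_ge0 //; lra.
exists (48^-1 * T), (6^-1 * (48^-1 * T * Num.sqrt chiW)),
  (6^-1 * (48^-1 * T * Num.sqrt chiA)).
split.
  split; apply: theta; try (by left); try by right.
  - by lra.
  - by rewrite mulr_ge0 ?sqrtr_ge0.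
  - by rewrite mulr_ge0 ?sqrtr_ge0.
move=> alg k acc.
(* A block out of reach in any one of the three counts already bounds the
   accuracy from below. *)
have far J : _ -> T <= 24 * J%:R := fun h => decay_bound mu0 muLF m0 m'0 q0 q1 qE
  kappa e0 (unreachable_error mu0 muLF m0 chiA1 dA acc h).
have steps (a p : nat) (chi : R) : (0 < p)%N -> Num.sqrt chi <= 6 * p%:R ->
    T <= 24 * (a %/ p + 2)%:R -> 6^-1 * (48^-1 * T * Num.sqrt chi) <= a%:R.
  move=> p0 chip Ta.
  have h1 : (a %/ p)%:R * p%:R <= a%:R :> R by rewrite -natrM ler_nat leq_trunc_div.
  have p1 : 0 <= p%:R :> R by exact: ler0n.
  rewrite natrD in Ta.
  have h2 : 48^-1 * T <= (a %/ p)%:R by lra.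
  have h3 := ler_wpM2l N0 chip.
  have h4 := ler_wpM2r p1 h2.
  by lra.
(* [zigzag_ge] excludes every block [J] with [a + p < J * p]; this is the first. *)
have far_step (a p : nat) : (0 < p)%N -> (a + p < (a %/ p + 2) * p)%N.
  move=> p0; rewrite mulnDl {1}(divn_eq a p) -addnA ltn_add2l mul2n -addnn.
  by rewrite ltn_add2r ltn_pmod.
split.
- set l := action_count alg LocalComputation k.
  have : T <= 24 * (l + 1)%:R by apply: far; rewrite addn1 ltnSn.
  by rewrite natrD; lra.
- apply: (steps _ m) => //; apply: far.
  by rewrite far_step // orbT.
- apply: (steps _ m') => //; apply: far.
  by rewrite far_step // !orbT.
Qed.
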